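(* Let $\mathcal{M}$ be a compact, connected $C^\infty$-manifold without boundary that is not simply connected, i.e. $\pi_1(\mathcal{M}) \neq \{0\}$. Then for every Riemannian metric $g$ on $\mathcal{M}$ and every real parameter $\lambda > 0$, the Gaussian kernel $$k_\lambda : \mathcal{M} \times \mathcal{M} \to [0,\infty), \qquad k_\lambda(x,y) := e^{-\lambda\, d_g(x,y)^2},$$ is not positive definite, where $d_g$ denotes the geodesic distance on $(\mathcal{M},g)$.
   Context: Geodesic distance: for a connected Riemannian manifold $(\mathcal{M},g)$ and $x,y\in\mathcal{M}$, $d_g(x,y)$ is the infimum of the $g$-lengths of all piecewise $C^1$ curves in $\mathcal{M}$ joining $x$ to $y$. Positive definite kernel: for a metric space $(X,d)$, a symmetric function $k: X \times X \to \mathbb{R}$ is called positive definite if for every $N \in \mathbb{N}$ and all points $x_1,\ldots,x_N \in X$, the $N\times N$ real Gram matrix with entries $\mathcal{G}_{ij} := k(x_i,x_j)$ is positive semi-definite. (Thus ''positive definite'' for kernels refers to positive semi-definiteness of all Gram matrices.) *)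

(* Defs.v *)
From mathcomp Require Import all_boot all_order all_algebra.
From mathcomp Require Import all_classical all_reals all_analysis.

Set Implicit Arguments.
Unset Strict Implicit.
Unset Printing Implicit Defensive.

Import Order.TTheory GRing.Theory Num.Theory.
Import numFieldNormedType.Exports.

Local Open Scope classical_set_scope.
Local Open Scope ring_scope.

Section Calculus.
Context {R : realType}.

(* Only meant for open [U]: all iterated directional derivatives exist and are
   continuous on [U].  The values of [f] outside [U] are then irrelevant. *)
Definition smooth_on {V W : normedModType R} (U : set V) (f : V -> W) :=
  forall (vs : seq V) (x : V), U x ->
    let df := foldr (fun v h => 'D_v h) f vs in
    {for x, continuous df} /\ forall v, derivable df x v.

(* Derivative at [t] of the restriction of [f] to [A]; one-sided when [A] is an
   interval and [t] is one of its end points. *)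
Definition diffquot {V : normedModType R} (f : R -> V) (t u : R) : V :=
  (u - t)^-1 *: (f u - f t).

Definition derivable_within {V : normedModType R} (A : set R) (f : R -> V)
    (t : R) : Prop :=
  cvg (diffquot f t @ within A t^').

Definition derive_within {V : normedModType R} (A : set R) (f : R -> V)
    (t : R) : V :=
  lim (diffquot f t @ within A t^').

End Calculus.

Section FundamentalGroup.
Variables (R : realType) (M : topologicalType).

(* Paths are functions on the whole line, of which only the restriction to
   [0, 1] matters: two loops that agree on [0, 1] are homotopic. *)
Definition loops (x0 : M) : set (R -> M) :=
  [set f : R -> M | [/\ {within `[0, 1], continuous f}, f 0 = x0 & f 1 = x0]].

Definition loop_homotopic (x0 : M) (f g : R -> M) :=
  exists H : R * R -> M,
    [/\ {within `[0, 1] `*` `[0, 1], continuous H},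
        {in `[0, 1], forall s, H (0, s) = f s},
        {in `[0, 1], forall s, H (1, s) = g s}
      & {in `[0, 1], forall t, H (t, 0) = x0 /\ H (t, 1) = x0}].

Definition loop_class (x0 : M) (f : R -> M) : set (R -> M) :=
  loops x0 `&` loop_homotopic x0 f.

(* The underlying set of the fundamental group; its neutral element is
   [loop_class x0 (cst x0)]. *)
Definition pi1 (x0 : M) : set (set (R -> M)) := loop_class x0 @` loops x0.

Definition path_connected :=
  forall x y : M, exists f : R -> M,
    [/\ {within `[0, 1], continuous f}, f 0 = x & f 1 = y].

Definition simply_connected :=
  path_connected /\ forall x0 : M, pi1 x0 = [set loop_class x0 (cst x0)].

End FundamentalGroup.

Section Manifold.
Variables (R : realType) (n : nat) (M : topologicalType).

(* A homeomorphism from an open subset of [M] onto an open subset of R^n.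
   [chart_map] and [chart_inv] are total functions, with irrelevant values
   outside [chart_dom] and [chart_map @` chart_dom] respectively. *)
Record chart := Chart {
  chart_dom : set M;
  chart_map :> M -> 'rV[R]_n;
  chart_inv : 'rV[R]_n -> M;
  chart_dom_open : open chart_dom;
  chart_img_open : open (chart_map @` chart_dom);
  chart_mapK : {in chart_dom, cancel chart_map chart_inv};
  chart_map_continuous : {within chart_dom, continuous chart_map};
  chart_inv_continuous :
    {within chart_map @` chart_dom, continuous chart_inv} }.

Definition transition (c c' : chart) : 'rV[R]_n -> 'rV[R]_n :=
  c' \o chart_inv c.

(* A smooth structure is given by an atlas, not necessarily maximal: neither
   the Riemannian metrics nor the piecewise C^1 curves below depend on the atlas
   chosen for a given smooth structure.  All charts take values in open subsets
   of R^n, so that there is no boundary. *)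
Record smooth_atlas := SmoothAtlas {
  atlas_charts : set chart;
  atlas_cover : forall x : M, exists c, atlas_charts c /\ chart_dom c x;
  atlas_smooth : forall c c', atlas_charts c -> atlas_charts c' ->
    smooth_on (c @` (chart_dom c `&` chart_dom c')) (transition c c') }.

Definition chart_at (A : smooth_atlas) (x : M) : chart :=
  projT1 (cid (atlas_cover A x)).

(* [metric_mx c x] is the matrix, at the point [x], of the metric in the basis
   of coordinate vectors of [c].  With row vectors, the coordinates [v] of a
   tangent vector in [c] become [v *m 'J (transition c c') (c x)] in [c']. *)
Record riemannian_metric (A : smooth_atlas) := RiemannianMetric {
  metric_mx : chart -> M -> 'M[R]_n;
  metric_mx_sym : forall c x, atlas_charts A c -> chart_dom c x ->
    (metric_mx c x)^T = metric_mx c x;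
  metric_mx_posdef : forall c x (v : 'rV[R]_n),
    atlas_charts A c -> chart_dom c x ->
    v != 0 -> 0 < (v *m metric_mx c x *m v^T) 0 0;
  metric_mx_smooth : forall c, atlas_charts A c ->
    smooth_on (c @` chart_dom c) (metric_mx c \o chart_inv c);
  metric_mx_change : forall c c' x,
    atlas_charts A c -> atlas_charts A c' ->
    chart_dom c x -> chart_dom c' x ->
    let J := 'J (transition c c') (c x) in
    metric_mx c x = J *m metric_mx c' x *m J^T }.

Definition C1_curve (A : smooth_atlas) (gam : R -> M) (a b : R) :=
  {within `[a, b], continuous gam} /\
  forall (c : chart) (t : R),
    atlas_charts A c -> t \in `[a, b] -> chart_dom c (gam t) ->
    let dgam := derive_within `[a, b] (c \o gam) in
    derivable_within `[a, b] (c \o gam) t /\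
    dgam @ within `[a, b] (nbhs t) --> dgam t.

Definition piecewise_C1_curve (A : smooth_atlas) (gam : R -> M) (a b : R) :=
  exists2 s : seq R, itv_partition a b s &
    forall i, (i < size s)%N ->
      C1_curve A gam (nth a (a :: s) i) (nth a s i).

Section Length.
Variables (A : smooth_atlas) (g : riemannian_metric A).

(* The norm of the velocity, which does not depend on the chart used around
   [gam t].  On a piecewise C^1 curve the derivative may fail to exist at
   finitely many points only, which do not contribute to the length. *)
Definition speed (gam : R -> M) (t : R) : R :=
  let c := chart_at A (gam t) in
  let v := derive1 (c \o gam) t in
  Num.sqrt ((v *m metric_mx g c (gam t) *m v^T) 0 0).

Definition curve_length (gam : R -> M) (a b : R) : \bar R :=
  (\int[lebesgue_measure]_(t in `[a, b]) (speed gam t)%:E)%E.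

(* On a connected manifold the infimum is finite, so that [fine] is harmless. *)
Definition geodesic_dist (x y : M) : R :=
  fine (ereal_inf [set L | exists (a b : R) (gam : R -> M),
    [/\ a < b, piecewise_C1_curve A gam a b, gam a = x, gam b = y
      & L = curve_length gam a b]]).

Definition gaussian_kernel (lam : R) (x y : M) : R :=
  expR (- lam * geodesic_dist x y ^+ 2).

End Length.
End Manifold.

Definition psdmx {R : realType} {N : nat} (G : 'M[R]_N) :=
  forall v : 'rV[R]_N, 0 <= (v *m G *m v^T) 0 0.

(* A notion about symmetric [k] only.  Symmetry is presupposed rather than a
   conjunct, so that the negation asserts that some Gram matrix is not positive
   semi-definite. *)
Definition positive_definite_kernel {R : realType} {X : Type}
    (k : X -> X -> R) :=
  forall (N : nat) (x : 'I_N -> X), psdmx (\matrix_(i, j) k (x i) (x j)).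

(* Main.v *)
(* Let L be the systole, that is the infimum of the lengths of the noncontractible
   loops.  A loop of length at most L + e that is not contractible is an
   almost isometric circle: a shortcut between two of its points splits it into
   two loops, at least one of which is not contractible, so the shortcut has
   length at least that of the shorter arc, up to e.  On a circle of length L,
   the distance to a point z has a corner at the point m antipodal to z.  The
   second difference at m, with step h, of the Gaussian kernel centred at z is
   therefore of order h, whereas the Cauchy-Schwarz inequality for a positive
   definite kernel bounds its square by the norm of the second difference of
   the kernel itself, which is of order h^4.  This contradiction involves four
   points only, and tolerates an error e on their distances, so that no closed
   geodesic is needed.

   Loops are replaced by chains of points at consecutive distances less than a
   small delta, and their homotopies by the insertion and deletion of points in
   small triangles: a loop whose chains are null in this sense is null-homotopic as
   soon as each ball of radius 2 delta lies in a coordinate ball. *)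

From HB Require Import structures.
Require Import Defs.
From mathcomp Require Import all_boot all_order all_algebra.
From mathcomp Require Import all_classical all_reals all_analysis.
From mathcomp.analysis Require Import measurable_realfun.
From mathcomp Require Import ring lra.
Set Implicit Arguments.
Unset Strict Implicit.
Unset Printing Implicit Defensive.
Import Order.TTheory GRing.Theory Num.Theory.
Import numFieldNormedType.Exports.
Local Open Scope classical_set_scope.
Local Open Scope ring_scope.

(** The argument on chains sees only a metric space with points almost between two given ones. The
    passage to topology goes one way: a loop that is not null-homotopic yields a chain that is not
    null. The Riemannian part thus has to supply four facts about [geodesic_dist]: it is a finite
    metric, its balls are neighbourhoods, almost minimal paths exist, and all balls of one small
    radius lie in coordinate balls. The last one is the delicate one, because a short curve might
    leave its chart; it takes a lower bound on lengths by a Lipschitz function defined on all of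
    [M].

    A second obstacle is that lengths integrate a [speed] that is computed in a chart chosen without
    regularity and by a two-sided derivative, which means nothing at break points. Lengths are
    therefore compared with increments over small intervals around each parameter, and these local
    inequalities are added up.

    In the final contradiction, [h] is half of D e^(-lam D^2), where D is half the systole: the two
    sides to be compared are then 16 lam^2 h^4 and 14 lam^2 h^4. *)

Section Interval.
Variable R : realType.

(* Cousin's lemma; it replaces the fundamental theorem of calculus in what follows. *)
Lemma interval_local_to_global (P : R -> R -> Prop) (a b : R) : a <= b ->
  (forall u t v, a <= u <= t -> t <= v <= b -> P u t -> P t v -> P u v) ->
  (forall t, a <= t <= b -> exists2 e, 0 < e &
    forall u v, a <= u <= t -> t <= v <= b -> t - e < u -> v < t + e -> P u v) ->
  P a b.
Proof.
move=> ab Padd Ploc.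
pose S := [set t | a <= t <= b /\ P a t].
have Sa : S a.
  split; first by rewrite lexx.
  have [|e e0 He] := Ploc a; first by rewrite lexx.
  by apply: He; rewrite ?lexx//; lra.
have hS : has_sup S by split; [exists a|exists b => t [/andP[]]].
pose s := sup S.
have as_ : a <= s by apply: ub_le_sup => //; exact: hS.2.
have sb : s <= b by apply: ge_sup; [exact: hS.1|move=> t [/andP[]]].
have [|e e0 He] := Ploc s; first by rewrite as_.
have [t [/andP[ta tb] Pat] st] := sup_adherent e0 hS.
have ts : t <= s by apply: ub_le_sup; [exact: hS.2|split => //; rewrite ta].
have [bs|sltb] := leP b s.
  have -> : b = s by lra.
  apply: (Padd _ t) => //; rewrite ?lexx ?ta//; first by rewrite ts.
  by apply: He; rewrite ?ta ?ts ?lexx//; lra.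
pose v := Order.min b (s + e / 2).
have vb : v <= b by rewrite /v ge_min lexx.
have sv : s < v by rewrite /v lt_min sltb/=; lra.
have ve : v < s + e by rewrite /v gt_min; apply/orP; right; lra.
have : S v.
  split; first by apply/andP; lra.
  apply: (Padd _ t) => //; rewrite ?lexx ?ta//; first by apply/andP; lra.
  by apply: He; rewrite ?ta ?ts ?vb ?(ltW sv).
by move=> /(ub_le_sup hS.2); rewrite -/s leNgt sv.
Qed.

Lemma continuous_glue (T U : topologicalType) (phi : T -> R) (a : R)
    (f g : T -> U) :
  continuous phi -> continuous f -> continuous g ->
  (forall p, phi p = a -> f p = g p) ->
  continuous (fun p => if phi p <= a then f p else g p).
Proof.
move=> cphi cf cg fg p A; have [lt|gt|eq] := ltgtP (phi p) a => nA.
- suff : \forall q \near p, A (if phi q <= a then f q else g q) by [].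
  have nf : \forall q \near p, A (f q) by exact: cf.
  have np : \forall q \near p, phi q < a by exact: (cvgr_lt _ (cphi p)).
  near=> q; rewrite ifT; first by near: q.
  by apply: ltW; near: q.
- suff : \forall q \near p, A (if phi q <= a then f q else g q) by [].
  have ng : \forall q \near p, A (g q) by exact: cg.
  have np : \forall q \near p, a < phi q by exact: (cvgr_gt _ (cphi p)).
  near=> q; rewrite ifF; first by near: q.
  by apply/negbTE; rewrite -ltNge; near: q.
- suff : \forall q \near p, A (if phi q <= a then f q else g q) by [].
  have nf : \forall q \near p, A (f q) by exact: cf.
  have ng : \forall q \near p, A (g q) by apply: cg; rewrite -fg.
  by near=> q; case: ifP => _; near: q.
Unshelve. all: by end_near. Qed.

Lemma continuous_pair (S T U : topologicalType) (f : S -> T) (g : S -> U) :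
  continuous f -> continuous g -> continuous (fun p => (f p, g p)).
Proof. by move=> cf cg p; apply: cvg_pair; [exact: cf|exact: cg]. Qed.

Lemma continuous_compose (S T U : topologicalType) (f : S -> T) (g : T -> U) :
  continuous f -> continuous g -> continuous (fun p => g (f p)).
Proof. by move=> cf cg p; apply: (@continuous_comp _ _ _ f g); [exact: cf|exact: cg]. Qed.

(** Composing with this retraction turns a map continuous within a segment into one continuous on
    the whole line, so that homotopies can be glued from total continuous maps. *)
Definition clamp (a b t : R) : R := Order.max a (Order.min t b).

Lemma clamp_itv a b t : a <= b -> a <= clamp a b t <= b.
Proof. by move=> ab; rewrite /clamp le_max lexx ge_max ab ge_min lexx orbT. Qed.

Lemma clamp_id a b t : a <= t <= b -> clamp a b t = t.
Proof. by move=> /andP[at_ tb]; rewrite /clamp min_l// max_r. Qed.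

Lemma continuous_clamp a b : continuous (clamp a b).
Proof.
move=> t; rewrite /clamp; apply: (@continuous_max R R (cst a) (Order.min^~ b)).
  exact: cvg_cst.
by apply: (@continuous_min R R id (cst b)); [exact: cvg_id|exact: cvg_cst].
Qed.

Lemma continuous_within_comp (S T U : topologicalType) (A : set T)
    (h : S -> T) (f : T -> U) :
  {within A, continuous f} -> continuous h -> (forall x, A (h x)) ->
  continuous (f \o h).
Proof.
move=> cf ch Ah x; apply: (@cvg_comp _ _ _ h f _ (within A (nbhs (h x)))).
  move=> B; rewrite /within/= => nB.
  have nB' : \forall y \near x, A (h y) -> B (h y) by exact: (ch x _ nB).
  suff : \forall y \near x, B (h y) by [].
  by apply: filterS nB' => y; apply; exact: Ah.
by rewrite (nbhs_subspace_in (Ah x)); exact: cf.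
Qed.

End Interval.

(** * The Gaussian kernel at a corner of the distance *)

Section FourPoints.
Variables (R : realType) (lam : R).
Hypothesis lam_gt0 : 0 < lam.

Definition gauss (t : R) : R := expR (- lam * t ^+ 2).

Lemma gauss_le (s t : R) : 0 <= s -> s <= t -> gauss t <= gauss s.
Proof.
move=> s0 st; rewrite /gauss ler_expR !mulNr lerN2.
by rewrite ler_wpM2l ?(ltW lam_gt0)// lerXn2r// nnegrE (le_trans s0).
Qed.

Lemma continuous_gauss : continuous gauss.
Proof.
move=> t; apply: (@continuous_comp R R R (fun t => - lam * t ^+ 2) expR).
  by apply: cvgM; [exact: cvg_cst|exact: exprn_continuous].
exact: continuous_expR.
Qed.

(** With a = [gauss h], [gauss (2 * h)] is a^4, and 6 - 8a + 2a^4 has a double zero at a = 1. Since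
    0 <= 1 - a <= lam h^2, the terms 12(1 - a)^2 and 2(1 - a)^4 account for the constant 14, and the
    cubic term has the good sign. *)
Lemma gauss_second_difference_le (h : R) :
  6 - 8 * gauss h + 2 * gauss (2 * h) <= 14 * (lam * h ^+ 2) ^+ 2.
Proof.
have -> : gauss (2 * h) = gauss h ^+ 4.
  by rewrite /gauss -expRM_natl; congr expR; ring.
have a1 : gauss h <= 1 by rewrite /gauss -expR0 ler_expR mulNr oppr_le0 mulr_ge0 ?sqr_ge0// ltW.
have a0 : 0 < gauss h by exact: expR_gt0.
have ag : 1 - lam * h ^+ 2 <= gauss h.
  by apply: le_trans (expR_ge1Dx _); lra.
set a := gauss h in a1 a0 ag *; set y := lam * h ^+ 2 in ag *.
have e0 : 0 <= 1 - a by lra.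
have ey : 1 - a <= y by lra.
have e2 : (1 - a) ^+ 2 <= y ^+ 2 by rewrite lerXn2r// nnegrE; lra.
have -> : 6 - 8 * a + 2 * a ^+ 4 =
    12 * (1 - a) ^+ 2 - 8 * (1 - a) ^+ 3 + 2 * (1 - a) ^+ 4 by ring.
have e3 : (1 - a) ^+ 4 <= (1 - a) ^+ 2.
  by rewrite ler_wiXn2l//; lra.
have e4 : 0 <= (1 - a) ^+ 3 by exact: exprn_ge0.
lra.
Qed.

(** The exponents differ by lam h (2D - h) >= lam h D, and e^x >= 1 + x. The gain is of first order
    in [h]: this is the contribution of the corner. *)
Lemma gauss_drop_ge (D h : R) : 0 <= h <= D ->
  gauss D * (lam * h * D) <= gauss (D - h) - gauss D.
Proof.
move=> /andP[h0 hD].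
have -> : gauss (D - h) = gauss D * expR (lam * h * (2 * D - h)).
  by rewrite /gauss -expRD; congr expR; ring.
rewrite -[X in _ <= _ - X]mulr1 -mulrBr ler_wpM2l ?expR_ge0//.
have := expR_ge1Dx (lam * h * (2 * D - h)).
suff : lam * h * D <= lam * h * (2 * D - h) by lra.
by rewrite ler_wpM2l ?mulr_ge0 ?(ltW lam_gt0)//; lra.
Qed.

Variables (X : Type) (d : X -> X -> R).
Hypothesis d_ge0 : forall x y, 0 <= d x y.
Hypothesis d_xx : forall x, d x x = 0.
Hypothesis d_sym : forall x y, d x y = d y x.

(* The quadratic form of the Gram matrix of p, m, q, z at (1, -2, 1, -w), where
   w is the second difference at p, m, q of the kernel centred at z. *)
Lemma gram_second_difference (p m q z : X) :
  let k x y := gauss (d x y) in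
  positive_definite_kernel k ->
  (k p z + k q z - 2 * k m z) ^+ 2 <= 6 - 4 * k p m - 4 * k m q + 2 * k p q.
Proof.
move=> k kpd; set w := k p z + k q z - 2 * k m z.
have kxx x : k x x = 1 by rewrite /k d_xx /gauss expr0n mulr0 expR0.
have ksym x y : k x y = k y x by rewrite /k d_sym.
have := kpd 4%N (fun i => nth p [:: p; m; q; z] i)
  (\row_j nth 0 [:: 1; -2; 1; - w] j).
rewrite !mxE !big_ord_recl big_ord0 !mxE !big_ord_recl !big_ord0 !mxE /=.
rewrite !kxx (ksym m p) (ksym q p) (ksym z p) (ksym q m) (ksym z m) (ksym z q).
(* The form equals S - w^2, where S is the right-hand side: [z] contributes -2w^2 through the cross
   terms and w^2 through its diagonal entry 1. *)
rewrite /w; nra.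
Qed.

(* On an isometric circle of length 2D, the second difference of the kernel at
   p, m, q has squared norm O(h^4), whereas its pairing with the antipode z of m
   is of order h since the distance to z has a corner at m. *)
Lemma gauss_not_positive_definite (D : R) : 0 < D ->
  (forall h e : R, 0 < h -> 2 * h <= D -> 0 < e -> exists p m q z,
    [/\ d p m <= h, d m q <= h, 2 * h - e <= d p q
      & [/\ D - e <= d m z, d q z <= D - h & d p z <= D - h + e]]) ->
  ~ positive_definite_kernel (fun x y => gauss (d x y)).
Proof.
move=> D0 config kpd.
have gD0 : 0 < gauss D by exact: expR_gt0.
have gD1 : gauss D <= 1.
  by rewrite /gauss -expR0 ler_expR mulNr oppr_le0 mulr_ge0 ?sqr_ge0// ltW.
(* With this [h] the lower bound [2 * gauss D * lam * h * D] on the second difference becomes 4 lam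
   h^2, whose square exceeds the 14 lam^2 h^4 of [gauss_second_difference_le]; [gauss D <= 1] gives
   2h <= D. *)
pose h := gauss D * D / 2.
have h0 : 0 < h by rewrite /h; nra.
have hD : 2 * h <= D by rewrite /h; nra.
(* When the distances carry an error [e], [w e] bounds the second difference from below and [u e]
   bounds the squared norm from above. The strict inequality between [u 0] and the square of [w 0]
   persists for small [e] by continuity, and only then are the four points chosen. *)
pose w e := gauss (D - h) + gauss (D - h + e) - 2 * gauss (D - e).
pose u e := 6 - 8 * gauss h + 2 * gauss (2 * h - e).
have cont_w : continuous w.
  move=> e; apply: cvgB; first (apply: cvgD; first exact: cvg_cst).
    apply: (@continuous_comp R R R (fun e => D - h + e) gauss); last exact: continuous_gauss.
    by apply: cvgD; [exact: cvg_cst|exact: cvg_id].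
  apply: cvgM; first exact: cvg_cst.
  apply: (@continuous_comp R R R (fun e => D - e) gauss); last exact: continuous_gauss.
  by apply: cvgB; [exact: cvg_cst|exact: cvg_id].
have cont_u : continuous u.
  move=> e; apply: cvgD; first exact: cvg_cst.
  apply: cvgM; first exact: cvg_cst.
  apply: (@continuous_comp R R R (fun e => 2 * h - e) gauss); last exact: continuous_gauss.
  by apply: cvgB; [exact: cvg_cst|exact: cvg_id].
have wpos : 2 * gauss D * lam * h * D <= w 0.
  have := @gauss_drop_ge D h; rewrite (ltW h0)/= /w addr0 subr0.
  have hD' : h <= D by lra.
  by move=> /(_ hD'); lra.
have t0 : 0 < 2 * gauss D * lam * h * D by rewrite !mulr_gt0.
have w0 : 0 < w 0 by exact: lt_le_trans wpos.
have uw : u 0 - w 0 ^+ 2 < 0.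
  have hle : u 0 <= 14 * (lam * h ^+ 2) ^+ 2.
    by rewrite /u subr0; exact: gauss_second_difference_le.
  have wle : (2 * gauss D * lam * h * D) ^+ 2 <= w 0 ^+ 2.
    by rewrite lerXn2r// nnegrE ltW.
  suff : 14 * (lam * h ^+ 2) ^+ 2 < (2 * gauss D * lam * h * D) ^+ 2 by lra.
  have -> : 2 * gauss D * lam * h * D = 4 * (lam * h ^+ 2) by rewrite /h; field.
  rewrite [in ltRHS]exprMn ltr_pM2r; first by lra.
  by rewrite exprn_gt0// mulr_gt0// exprn_gt0.
have near_w : \forall e \near (0 : R), 0 < w e by exact: (cvgr_gt _ (cont_w 0)).
have near_u : \forall e \near (0 : R), u e - w e ^+ 2 < 0.
  have cuw : u e - w e ^+ 2 @[e --> (0 : R)] --> u 0 - w 0 ^+ 2.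
    apply: cvgB; first exact: cont_u.
    by rewrite expr2; apply: cvgM; exact: cont_w.
  exact: (cvgr_lt _ cuw).
(* The bound e < h keeps 2h - e and D - e nonnegative, where [gauss] is decreasing. *)
have [e [/= e0 we ue eh]] : exists e : R, [/\ 0 < e, 0 < w e, u e - w e ^+ 2 < 0 & e < h].
  have : \forall e \near (0 : R)^'+, [/\ 0 < e, 0 < w e, u e - w e ^+ 2 < 0 & e < h].
    near=> e; split.
    - by near: e; exact: nbhs_right_gt.
    - by near: e; exact: (cvg_at_right_filter cvg_id near_w).
    - by near: e; exact: (cvg_at_right_filter cvg_id near_u).
    - by near: e; exact: nbhs_right_lt.
  by move=> /filter_ex.
have [p [m [q [z [pm mq pq [mz qz pz]]]]]] := config h e h0 hD e0.
have := gram_second_difference p m q z kpd => /=.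
have gpm : gauss h <= gauss (d p m) by exact: gauss_le.
have gmq : gauss h <= gauss (d m q) by exact: gauss_le.
have gpq : gauss (d p q) <= gauss (2 * h - e) by apply: gauss_le => //; lra.
have gmz : gauss (d m z) <= gauss (D - e) by apply: gauss_le => //; lra.
have gqz : gauss (D - h) <= gauss (d q z) by exact: gauss_le.
have gpz : gauss (D - h + e) <= gauss (d p z) by exact: gauss_le.
have wle : w e ^+ 2 <= (gauss (d p z) + gauss (d q z) - 2 * gauss (d m z)) ^+ 2.
  by rewrite lerXn2r// ?nnegrE; move: we; rewrite /w; lra.
by move: ue; rewrite /u; lra.
Unshelve. all: by end_near. Qed.

End FourPoints.

(** * Discrete homotopy of chains *)

Section Chains.
Variables (R : realType) (X : Type) (d : X -> X -> R) (delta : R).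
Hypothesis d_ge0 : forall x y, 0 <= d x y.
Hypothesis d_xx : forall x, d x x = 0.
Hypothesis d_sym : forall x y, d x y = d y x.
Hypothesis d_triangle : forall x y z, d x z <= d x y + d y z.
Hypothesis delta_gt0 : 0 < delta.

(** These are the edge-path homotopies of the Vietoris-Rips complex at scale [delta]; they fix the
    first and the last point of a chain. *)
Inductive chain_homotopic : seq X -> seq X -> Prop :=
| ChainRefl c : chain_homotopic c c
| ChainSym c c' : chain_homotopic c c' -> chain_homotopic c' c
| ChainTrans c c' c'' : chain_homotopic c c' -> chain_homotopic c' c'' ->
    chain_homotopic c c''
| ChainInsert p u x v q : d u v < delta -> d u x < delta -> d x v < delta ->
    chain_homotopic (p ++ u :: v :: q) (p ++ u :: x :: v :: q)
| ChainDup p u q : chain_homotopic (p ++ u :: q) (p ++ u :: u :: q).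

(* The chain with first point [x] and further points [s], as in [path]. *)
Definition chain_null x s := chain_homotopic (x :: s) [:: x].

Definition chain_path x s := path (fun u v => d u v < delta) x s.

Fixpoint chain_length x s : R :=
  if s is y :: s' then d x y + chain_length y s' else 0.

Lemma chain_length_ge0 x s : 0 <= chain_length x s.
Proof. by elim: s x => //= y s IH x; rewrite addr_ge0. Qed.

Lemma chain_length_cat x s t :
  chain_length x (s ++ t) = chain_length x s + chain_length (last x s) t.
Proof. by elim: s x => [|y s IH] x /=; rewrite ?add0r// IH addrA. Qed.

Lemma chain_homotopic_cat p q c c' : chain_homotopic c c' ->
  chain_homotopic (p ++ c ++ q) (p ++ c' ++ q).
Proof.
elim=> {c c'} [c|c c' _ IH|c c' c'' _ IH _ IH'|p' u x v q' uv ux xv|p' u q'].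
- exact: ChainRefl.
- exact: ChainSym.
- exact: ChainTrans IH IH'.
- rewrite -!catA !cat_cons [p ++ p' ++ _]catA [X in chain_homotopic _ X]catA.
  exact: ChainInsert.
- rewrite -!catA !cat_cons [p ++ p' ++ _]catA [X in chain_homotopic _ X]catA.
  exact: ChainDup.
Qed.

Lemma chain_homotopic_catl p c c' : chain_homotopic c c' ->
  chain_homotopic (p ++ c) (p ++ c').
Proof. by move=> /(chain_homotopic_cat p [::]); rewrite !cats0. Qed.

Lemma chain_homotopic_catr q c c' : chain_homotopic c c' ->
  chain_homotopic (c ++ q) (c' ++ q).
Proof. exact: (chain_homotopic_cat [::] q). Qed.

(** The innermost backtrack [z x z] lies in a degenerate triangle, so [x] can be deleted and the two
    copies of [z] merged; the rest follows by induction. *)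
Lemma chain_revK x s : chain_path x s ->
  chain_homotopic (rev (x :: s) ++ s) [:: last x s].
Proof.
elim: s x => [|z s IH] x /=; first by move=> _; exact: ChainRefl.
move=> /andP[xz zs]; apply: ChainTrans (IH z zs).
rewrite !rev_cons -!cats1 -!catA /=.
apply: ChainTrans (ChainSym (ChainDup _ _ _)); apply: ChainSym.
by apply: ChainInsert; rewrite ?d_xx// d_sym.
Qed.

Lemma last_rev_chain (x : X) s : last (last x s) (rev (belast x s)) = x.
Proof. by case: s => //= y s; rewrite rev_cons last_rcons. Qed.

Lemma rev_chainE (x : X) s : last x s :: rev (belast x s) = rev (x :: s).
Proof. by rewrite [in RHS]lastI rev_rcons. Qed.

Lemma rev_chain_path x s : chain_path x s ->
  chain_path (last x s) (rev (belast x s)).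
Proof.
rewrite /chain_path rev_path; under [in X in X -> _]eq_path do rewrite d_sym.
exact.
Qed.

Lemma rev_chain_length x s :
  chain_length (last x s) (rev (belast x s)) = chain_length x s.
Proof.
elim: s x => //= y s IH x; rewrite rev_cons -cats1 chain_length_cat IH.
by rewrite last_rev_chain /= addr0 d_sym addrC.
Qed.

(* The chain [a c b] is homotopic to [a (c s^-1) s b]. *)
Lemma chain_null_shortcut x a b c s :
  chain_path (last x a) s ->
  last (last x a) s = last (last x a) c ->
  chain_null (last x a) (c ++ rev (belast (last x a) s)) ->
  chain_null x (a ++ s ++ b) ->
  chain_null x (a ++ c ++ b).
Proof.
move=> sp sc cs; apply: ChainTrans.
set y := last x a in sp sc cs *.
have xa r : x :: a ++ r = belast x a ++ y :: r.
  by rewrite -cat_cons lastI -cats1 -catA.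
rewrite !xa; apply: chain_homotopic_catl.
apply: ChainTrans (y :: c ++ rev (belast y s) ++ s ++ b) _ _ _; last first.
  have := chain_homotopic_catr (s ++ b) cs.
  by rewrite /= -catA.
have -> : y :: c ++ rev (belast y s) ++ s ++ b =
    belast y c ++ (rev (y :: s) ++ s) ++ b.
  by rewrite -rev_chainE sc -!cat_cons lastI -cats1 -!catA.
rewrite -cat_cons lastI -cats1 -catA -sc.
apply: chain_homotopic_cat; apply: ChainSym; exact: chain_revK.
Qed.

(** By the triangle inequality the second point can be deleted within a triangle whose sides are all
    less than [delta], and the length does not increase. This is what makes the systole positive. *)
Lemma short_chain_null x s : last x s = x -> chain_length x s < delta ->
  chain_null x s.
Proof.
have [k] := ubnP (size s); elim: k s => // k IH [|y [|z s]] /=.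
- by move=> *; exact: ChainRefl.
- by move=> _ -> _; exact: (ChainSym (ChainDup [::] x [::])).
- rewrite !ltnS => sk lst lt.
  have s0 := chain_length_ge0 z s; have xy0 := d_ge0 x y; have yz0 := d_ge0 y z.
  have tri := d_triangle x y z.
  apply: (@ChainTrans _ (x :: z :: s)).
    by apply: ChainSym; apply: (ChainInsert [::]); lra.
  by apply: IH => //=; lra.
Qed.

Hypothesis d_between : forall x y (t e : R), 0 <= t <= d x y -> 0 < e ->
  exists z, d x z <= t /\ d z y <= d x y - t + e.

(** The cut at length [t] usually falls inside an edge, where an almost intermediate point is
    inserted; the insertion is a homotopy and costs at most [e] in length. *)
Lemma chain_split x s t e : chain_path x s -> 0 <= t <= chain_length x s ->
  0 < e -> exists a b, [/\ chain_path x a, chain_path (last x a) b,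
    last (last x a) b = last x s, chain_homotopic (x :: s) (x :: a ++ b)
    & chain_length x a <= t /\
      chain_length (last x a) b <= chain_length x s - t + e].
Proof.
elim: s x t => [|y s IH] x t /=.
  move=> _ t0 e0; exists [::], [::]; split => //=; first exact: ChainRefl.
  by lra.
move=> /andP[xy ys] /andP[t0 tl] e0; have [xyt|txy] := leP (d x y) t.
  have t' : 0 <= t - d x y <= chain_length y s by apply/andP; lra.
  have [a [b [ya ab lb h [la lb']]]] := IH y (t - d x y) ys t' e0.
  exists (y :: a), b; split => //=; first by rewrite xy.
    by have := chain_homotopic_catl [:: x] h.
  by lra.
(* The second bound keeps the new edge from [z] to [y] shorter than [delta]. *)
pose e' := Order.min e ((delta - d x y) / 2).
have e'0 : 0 < e' by rewrite /e' lt_min e0/=; lra.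
have e'e : e' <= e by rewrite /e' ge_min lexx.
have e'd : e' <= (delta - d x y) / 2 by rewrite /e' ge_min lexx orbT.
have t' : 0 <= t <= d x y by rewrite t0 ltW.
have [z [xz zy]] := d_between t' e'0.
exists [:: z], (y :: s); split => //=.
- by rewrite andbT; lra.
- by apply/andP; split => //; lra.
- by apply: (ChainInsert [::]) => //; lra.
- by have := chain_length_ge0 y s; lra.
Qed.

(** Induction on the number of steps of length [delta / 2] that suffice to cover the distance. *)
Lemma near_geodesic_chain x y (e : R) : 0 < e -> exists s,
  [/\ chain_path x s, last x s = y & chain_length x s <= d x y + e].
Proof.
have [k] : exists k : nat, d x y < k%:R * (delta / 2).
  exists (Num.truncn (d x y / (delta / 2))).+1.
  by rewrite -ltr_pdivrMr ?divr_gt0// truncnS_gt.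
elim: k x e => [|k IH] x e; first by have := d_ge0 x y; rewrite mul0r; lra.
move=> xyk e0; have [xy|dxy] := ltP (d x y) delta.
  by exists [:: y]; split => //=; rewrite ?xy//; lra.
(* The second bound is half of the slack in [d x y < k.+1%:R * (delta / 2)], so that the remaining
   distance [d z y] is covered by [k] steps. *)
pose e' := Order.min (e / 2) ((k.+1%:R * (delta / 2) - d x y) / 2).
have e'0 : 0 < e' by rewrite /e' lt_min; apply/andP; lra.
have e'e : e' <= e / 2 by rewrite /e' ge_min lexx.
have e'd : e' <= (k.+1%:R * (delta / 2) - d x y) / 2.
  by rewrite /e' ge_min lexx orbT.
have t' : 0 <= delta / 2 <= d x y.
  apply/andP; split; first by rewrite divr_ge0// ltW.
  by apply: le_trans dxy; rewrite ler_pdivrMr//; have := delta_gt0; lra.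
have [z [xz zy]] := d_between t' e'0.
have zyk : d z y < k%:R * (delta / 2).
  have kE : k.+1%:R * (delta / 2) = k%:R * (delta / 2) + delta / 2.
    by rewrite -natr1; ring.
  by move: e'd; rewrite kE; lra.
have [s [zs ls le]] := IH z (e / 2) zyk ltac:(lra).
exists (z :: s); split => //=; last by lra.
rewrite zs andbT; apply: le_lt_trans xz _.
  by rewrite ltr_pdivrMr//; have := delta_gt0; lra.
Qed.

Definition essential_lengths : set R := [set l | exists x s,
  [/\ chain_path x s, last x s = x, ~ chain_null x s & l = chain_length x s]].

Definition systole : R := inf essential_lengths.

Lemma essential_lengths_lb : lbound essential_lengths delta.
Proof.
move=> _ [x [s [_ xs ns ->]]]; rewrite leNgt; apply/negP => sl.
exact/ns/short_chain_null.
Qed.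

Lemma systole_le x s : chain_path x s -> last x s = x -> ~ chain_null x s ->
  systole <= chain_length x s.
Proof.
move=> xs lx ns; apply: ge_inf; last by exists x, s.
by exists delta; exact: essential_lengths_lb.
Qed.

Lemma chain_path_cat x a b :
  chain_path x (a ++ b) = chain_path x a && chain_path (last x a) b.
Proof. exact: cat_path. Qed.

(** Let [s] be an almost shortest chain between the ends of the arc [c]. If [c] followed by the
    reverse of [s] is null, then replacing [c] by [s] gives a loop that is still not null, and the
    complementary arc enters the bound; otherwise that closed chain is itself not null, and [c]
    enters it. The maximum covers both cases. *)
Lemma shortcut_length_ge x a c b :
  chain_path x (a ++ c ++ b) -> last x (a ++ c ++ b) = x ->
  ~ chain_null x (a ++ c ++ b) ->
  systole - Order.max (chain_length (last x a) c)
    (chain_length x (a ++ c ++ b) - chain_length (last x a) c)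
  <= d (last x a) (last (last x a) c).
Proof.
rewrite !chain_path_cat !last_cat => /and3P[pa pc pb] lx nn.
rewrite !chain_length_cat; set y := last x a in pc pb lx nn *.
set z := last y c in pb lx *.
apply/ler_addgt0Pr => e e0.
have [s [ys lz ls]] := near_geodesic_chain y z e0.
have [cs|ncs] := pselect (chain_null y (c ++ rev (belast y s))).
  have nasb : ~ chain_null x (a ++ s ++ b).
    by move=> h; apply: nn; apply: chain_null_shortcut cs h.
  have := systole_le _ _ nasb; rewrite !chain_path_cat !last_cat -/y lz pa ys pb.
  move=> /(_ isT lx); rewrite !chain_length_cat -/y lz => h.
  rewrite -/y -/z lerBlDr addrC -lerBlDr.
  by rewrite le_max; apply/orP; right; lra.
have := systole_le _ _ ncs.
rewrite !chain_path_cat !last_cat -/z -lz pc rev_chain_path// last_rev_chain.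
move=> /(_ isT erefl); rewrite chain_length_cat -/z -[in X in X -> _]lz.
rewrite rev_chain_length => h; rewrite -/y -/z.
have : chain_length y c <= Order.max (chain_length y c)
  (chain_length x a + (chain_length y c + chain_length z b) - chain_length y c).
  by rewrite le_max lexx.
by rewrite -/y lz; lra.
Qed.

(** On an almost shortest closed chain of length about L, the points [p], [m], [q], [z] sit at arc
    lengths 0, h, 2h and L/2 + h, so that [z] is opposite to [m]. Upper bounds on distances are
    lengths of arcs; lower bounds come from [shortcut_length_ge]. *)
Lemma circle_configuration : essential_lengths !=set0 ->
  0 < systole /\
  forall h e : R, 0 < h -> 2 * h <= systole / 2 -> 0 < e -> exists p m q z,
    [/\ d p m <= h, d m q <= h, 2 * h - e <= d p q
      & [/\ systole / 2 - e <= d m z, d q z <= systole / 2 - h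
        & d p z <= systole / 2 - h + e]].
Proof.
move=> ne; set L := systole.
have L0 : 0 < L.
  by apply: lt_le_trans delta_gt0 _; apply: lb_le_inf => //; exact: essential_lengths_lb.
split=> // h e h0 hL e0.
have hinf : has_inf essential_lengths.
  by split => //; exists delta; exact: essential_lengths_lb.
(* One share for the approximation of the infimum and one for each of the three cuts; all four
   accumulate in the last arc [b2]. *)
pose e' := e / 4; have e'E : e' = e / 4 by [].
have e'0 : 0 < e' by lra.
have [_ [x [s [xs lx ns ->]]] sL] := inf_adherent e'0 hinf.
rewrite -/L in sL.
have sL' := systole_le xs lx ns; rewrite -/L in sL'.
have dle u c : d u (last u c) <= chain_length u c.
  elim: c u => [|v c IH] u /=; first by rewrite d_xx.
  by apply: le_trans (d_triangle _ v _) _; rewrite lerD2l.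
have [||a [b [pa pb lb hab [la lb']]]] := @chain_split x s h e' xs => //.
  by apply/andP; lra.
set m := last x a in pb lb lb' *.
have nab : ~ chain_null x (a ++ b).
  by move=> nab; apply: ns; apply: ChainTrans hab nab.
have := systole_le _ _ nab; rewrite chain_path_cat last_cat -/m pa pb lb.
move=> /(_ isT lx); rewrite chain_length_cat -/m -/L => Lab.
have [||a' [b' [pa' pb' lb1 hab' [la' lb1']]]] := @chain_split m b h e' pb => //.
  by apply/andP; lra.
set q := last m a' in pb' lb1 lb1' *.
have xa r : x :: a ++ r = belast x a ++ m :: r.
  by rewrite -cat_cons lastI -cats1 -catA.
have hab2 : chain_homotopic (x :: a ++ b) (x :: a ++ a' ++ b').
  by rewrite !xa; apply: chain_homotopic_catl.
have nab' : ~ chain_null x (a ++ a' ++ b').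
  by move=> nab'; apply: nab; apply: ChainTrans hab2 nab'.
have := systole_le _ _ nab'; rewrite !chain_path_cat !last_cat -/m -/q pa pa' pb'.
rewrite lb1 lb => /(_ isT lx); rewrite !chain_length_cat -/m -/q -/L => Lab'.
have [||a2 [b2 [pa2 pb2 lb2 hab2' [la2 lb2']]]] :=
  @chain_split q b' (L / 2 - h) e' pb' => //.
  by apply/andP; lra.
set z := last q a2 in pb2 lb2 lb2' *.
have hab3 : chain_homotopic (x :: a ++ a' ++ b') (x :: a ++ a' ++ a2 ++ b2).
  rewrite !xa; apply: chain_homotopic_catl.
  have ma r : m :: a' ++ r = belast m a' ++ q :: r.
    by rewrite -cat_cons lastI -cats1 -catA.
  by rewrite !ma; apply: chain_homotopic_catl.
have nab2 : ~ chain_null x (a ++ a' ++ a2 ++ b2).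
  by move=> nab2; apply: nab'; apply: ChainTrans hab3 nab2.
have lz : last z b2 = x by rewrite lb2 lb1 lb.
have paths : chain_path x (a ++ a' ++ a2 ++ b2).
  by rewrite !chain_path_cat -/m -/q -/z pa pa' pa2 pb2.
exists x, m, q, z; split.
- exact: le_trans (dle _ _) la.
- exact: le_trans (dle _ _) la'.
- have := @shortcut_length_ge x [::] (a ++ a') (a2 ++ b2).
  rewrite /= -!catA => /(_ paths); rewrite !last_cat -/m -/q -/z lz.
  move=> /(_ erefl nab2); rewrite !chain_length_cat -/m -/q -/z -/L.
  apply: le_trans; rewrite lerBrDr addrC -lerBrDr ge_max; apply/andP; split; lra.
- split.
  + have := @shortcut_length_ge x a (a' ++ a2) b2.
    rewrite -!catA => /(_ paths); rewrite !last_cat -/m -/q -/z lz.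
    move=> /(_ erefl nab2); rewrite !chain_length_cat -/m -/q -/z -/L.
    apply: le_trans; rewrite lerBrDr addrC -lerBrDr ge_max; apply/andP; split; lra.
  + exact: le_trans (dle _ _) la2.
  + rewrite d_sym; apply: le_trans (_ : chain_length z b2 <= _).
      by rewrite -[X in d _ X]lz.
    lra.
Qed.

End Chains.

(** * Homotopy of loops *)

Section LoopHomotopy.
Variables (R : realType) (M : topologicalType).
Implicit Types (base : M) (f g : R -> M).
Local Notation clamp01 := (@clamp R 0 1).

Lemma clamp01_itv t : 0 <= clamp01 t <= 1.
Proof. by apply: clamp_itv; exact: ler01. Qed.

(** A homotopy on the square extends to the plane by clamping both coordinates, and total continuous
    maps are easier to glue. *)
Lemma loop_homotopicP base f g : loop_homotopic base f g <->
  exists H : R * R -> M, [/\ continuous H,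
    forall t, H (0, t) = f (clamp01 t), forall t, H (1, t) = g (clamp01 t)
    & forall s, H (s, 0) = base /\ H (s, 1) = base].
Proof.
have c0 : clamp01 0 = 0 by apply: clamp_id; rewrite lexx ler01.
have c1 : clamp01 1 = 1 by apply: clamp_id; rewrite lexx ler01.
split=> -[H [cH H0 H1 Hb]].
  exists (H \o (fun p => (clamp01 p.1, clamp01 p.2))); split => /=.
  - apply: (continuous_within_comp cH).
      apply: continuous_pair; apply: continuous_compose (@continuous_clamp _ _ _).
        by move=> p; exact: cvg_fst.
      by move=> p; exact: cvg_snd.
    by move=> p; split => /=; rewrite in_itv/= clamp01_itv.
  - by move=> t; rewrite c0 H0// in_itv/= clamp01_itv.
  - by move=> t; rewrite c1 H1// in_itv/= clamp01_itv.
  - by move=> s; rewrite c0 c1; apply: Hb; rewrite in_itv/= clamp01_itv.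
exists H; split.
- exact: continuous_subspaceT.
- by move=> t; rewrite in_itv/= => t01; rewrite H0 clamp_id.
- by move=> t; rewrite in_itv/= => t01; rewrite H1 clamp_id.
- by move=> t _; exact: Hb.
Qed.

Lemma loop_homotopic_sym base f g : loop_homotopic base f g -> loop_homotopic base g f.
Proof.
move=> /loop_homotopicP[H [cH H0 H1 Hb]]; apply/loop_homotopicP.
exists (H \o (fun p => (1 - p.1, p.2))); split => /=.
- apply: continuous_compose cH; apply: continuous_pair => p; last exact: cvg_snd.
  by apply: cvgB; [exact: cvg_cst|exact: cvg_fst].
- by move=> t; rewrite subr0.
- by move=> t; rewrite subrr.
- by move=> s; exact: Hb.
Qed.

Lemma loop_homotopic_trans base f g h :
  loop_homotopic base f g -> loop_homotopic base g h -> loop_homotopic base f h.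
Proof.
move=> /loop_homotopicP[H [cH H0 H1 Hb]] /loop_homotopicP[K [cK K0 K1 Kb]].
apply/loop_homotopicP.
exists (fun p => if p.1 <= 1 / 2 then H (2 * p.1, p.2) else K (2 * p.1 - 1, p.2)).
split => /=.
- apply: (@continuous_glue _ _ _ fst); first by move=> p; exact: cvg_fst.
  + apply: continuous_compose cH; apply: continuous_pair => p; last exact: cvg_snd.
    by apply: cvgM; [exact: cvg_cst|exact: cvg_fst].
  + apply: continuous_compose cK; apply: continuous_pair => p; last exact: cvg_snd.
    apply: cvgB; last exact: cvg_cst.
    by apply: cvgM; [exact: cvg_cst|exact: cvg_fst].
  + move=> [s t] /= ->.
    have -> : 2 * (1 / 2) = 1 :> R by lra.
    by rewrite subrr H1 K0.
- move=> t; have -> : (0 : R) <= 1 / 2 by lra.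
  by rewrite mulr0 H0.
- move=> t; have -> : (1 <= 1 / 2 :> R) = false by apply/negbTE; lra.
  have -> : 2 * 1 - 1 = 1 :> R by lra.
  by rewrite K1.
- by move=> s; case: ifP => _; [exact: Hb|exact: Kb].
Qed.

Lemma simply_connected_null_loops : path_connected R M ->
  (forall base f, loops base f -> loop_homotopic base f (cst base)) ->
  simply_connected R M.
Proof.
move=> pc null; split => // base; apply/seteqP; split => [_ [f lf <-]|_ ->] /=.
  apply/seteqP; split => g [lg fg]; split => //.
    by apply: loop_homotopic_trans fg; apply: loop_homotopic_sym; exact: null.
  by apply: loop_homotopic_trans fg; exact: null.
exists (cst base) => //; split => //.
by apply: continuous_subspaceT => t; exact: cvg_cst.
Qed.

(* This is all that is needed of the segments between points of a coordinate
   ball; the path [kap (_, (y, z))] need not stay in [B]. *)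
Definition deformable (B : set M) := exists kap : R * (M * M) -> M,
  [/\ forall s y z, 0 <= s <= 1 -> B y -> B z ->
        {for (s, (y, z)), continuous kap},
      forall y z, B y -> B z -> kap (0, (y, z)) = y,
      forall y z, B y -> B z -> kap (1, (y, z)) = z
    & forall s y, 0 <= s <= 1 -> B y -> kap (s, (y, y)) = y].

(** On [[a, b]] the point [f t] is moved to [g t] along [kap], and elsewhere it stays. The pieces
    match because [f] and [g] agree at [a] and [b], and [kap] is stationary between equal points. *)
Lemma deformable_homotopic base B f g a b : deformable B ->
  continuous f -> continuous g -> f 0 = base -> f 1 = base ->
  0 <= a -> a <= b -> b <= 1 ->
  (forall t, 0 <= t <= a -> f t = g t) -> (forall t, b <= t <= 1 -> f t = g t) ->
  (forall t, a <= t <= b -> B (f t) /\ B (g t)) -> loop_homotopic base f g.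
Proof.
move=> [kap [ck kap0 kap1 kapx]] cf cg f0 f1 a0 ab b1 fga fgb BB.
have BBc t : B (f (clamp a b t)) /\ B (g (clamp a b t)).
  by apply: BB; exact: clamp_itv.
(* Clamping both parameters keeps the arguments in the region where [kap] is known to be continuous,
   so that [mid] is continuous everywhere. *)
pose mid (p : R * R) :=
  kap (clamp01 p.1, (f (clamp a b p.2), g (clamp a b p.2))).
pose H (p : R * R) := if p.2 <= a then f p.2 else
  if p.2 <= b then mid p else f p.2.
have cfs : continuous (fun p : R * R => f p.2).
  by apply: continuous_compose cf => p; exact: cvg_snd.
have csnd : continuous (fun p : R * R => clamp a b p.2).
  by apply: continuous_compose (@continuous_clamp _ _ _) => p; exact: cvg_snd.
have cfst : continuous (fun p : R * R => clamp01 p.1).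
  by apply: continuous_compose (@continuous_clamp _ _ _) => p; exact: cvg_fst.
have cH : continuous H.
  apply: (@continuous_glue _ _ _ snd) => //; first by move=> p; exact: cvg_snd.
    apply: (@continuous_glue _ _ _ snd) => //; first by move=> p; exact: cvg_snd.
      move=> p; have [Bf Bg] := BBc p.2.
      apply: (@continuous_comp _ _ _ (fun p : R * R =>
        (clamp01 p.1, (f (clamp a b p.2), g (clamp a b p.2)))) kap).
        apply: continuous_pair => //; apply: continuous_pair.
          exact: continuous_compose cf.
        exact: continuous_compose cg.
      by apply: ck => //; exact: clamp01_itv.
    move=> [s t] /= tb; rewrite /mid /= tb (@clamp_id R a b) ?ab ?lexx//.
    have gf : g b = f b by rewrite fgb// lexx b1.
    by rewrite gf kapx//; [exact: clamp01_itv|by apply: (BB b _).1; rewrite ab lexx].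
  move=> [s t] /= ta; rewrite ta ab /mid /= (@clamp_id R a b) ?lexx ?ab//.
  have gf : g a = f a by rewrite fga// a0 lexx.
  by rewrite gf kapx//; [exact: clamp01_itv|by apply: (BB a _).1; rewrite ab lexx].
have Hout s t : t <= a \/ b <= t -> H (s, t) = f t.
  rewrite /H /= => -[->//|bt]; case: ifPn => // _; case: ifPn => // tb.
  have -> : t = b by apply/eqP; rewrite eq_le tb bt.
  rewrite /mid /= (@clamp_id R a b) ?ab ?lexx//.
  have gf : g b = f b by rewrite fgb// lexx b1.
  by rewrite gf kapx//; [exact: clamp01_itv|by apply: (BB b _).1; rewrite ab lexx].
have c0 : clamp01 0 = 0 by apply: clamp_id; rewrite lexx ler01.
have c1 : clamp01 1 = 1 by apply: clamp_id; rewrite lexx ler01.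
exists H; split; first exact: continuous_subspaceT.
- move=> t _; rewrite /H /=; case: ifPn => // ta; case: ifPn => // tb.
  have [Bf Bg] := BBc t; rewrite /mid /= c0 kap0// clamp_id// tb andbT.
  by rewrite ltW// ltNge.
- move=> t; rewrite in_itv/= => /andP[t0 t1]; rewrite /H /=.
  case: ifPn => [ta|ta]; first by rewrite fga// t0.
  case: ifPn => tb; last by rewrite fgb// t1 andbT ltW// ltNge.
  have [Bf Bg] := BBc t; rewrite /mid /= c1 kap1// clamp_id// tb andbT.
  by rewrite ltW// ltNge.
- by move=> s _; rewrite !Hout//; [right|left].
Qed.

Variables (d : M -> M -> R) (delta : R).
Hypothesis d_ge0 : forall x y, 0 <= d x y.
Hypothesis d_xx : forall x, d x x = 0.
Hypothesis d_sym : forall x y, d x y = d y x.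
Hypothesis d_triangle : forall x y z, d x z <= d x y + d y z.
Hypothesis d_nbhs : forall x e, 0 < e -> nbhs x [set y | d x y < e].
Hypothesis delta_gt0 : 0 < delta.
Hypothesis d_deformable : forall y, exists2 B, deformable B &
  forall z, d y z < 2 * delta -> B z.
Hypothesis d_path : forall u v, d u v < delta -> exists p : R -> M,
  [/\ continuous p, p 0 = u, p 1 = v & forall t, d u (p t) < delta].

(* The map [f] runs along the chain [c] on [[a, b]]: each point of [c] owns a
   nondegenerate subinterval, at whose left end [f] takes that point as value
   and on which [f] stays [delta]-close to it. *)
Fixpoint adapted f (b a : R) (c : seq M) : Prop :=
  if c is x :: c' then f a = x /\
    if c' is [::] then a < b /\ forall t, a <= t <= b -> d x (f t) < delta
    else exists a', [/\ a < a', forall t, a <= t <= a' -> d x (f t) < delta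
      & adapted f b a' c']
  else False.

Lemma adapted_lt f b a c : adapted f b a c -> a < b.
Proof.
elim: c a => // x [|y c] IH a; first by move=> [_ []].
by move=> [_ [a' [aa' _ /IH]]]; exact: lt_trans.
Qed.

Lemma adapted_ext f g b a c : (forall t, a <= t <= b -> f t = g t) ->
  adapted f b a c -> adapted g b a c.
Proof.
elim: c a => // x [|y c] IH a fg.
  move=> [fa [ab fx]]; split; first by rewrite -fg// lexx ltW.
  by split => // t tab; rewrite -fg//; exact: fx.
move=> [fa [a' [aa' fx ad]]]; have a'b := @adapted_lt f b a' (y :: c) ad.
split; first by rewrite -fg// lexx/= ltW// (lt_trans aa').
exists a'; split => //.
  move=> t /andP[at_ ta']; rewrite -fg; first by apply: fx; rewrite at_.
  by rewrite at_/= (le_trans ta')// ltW.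
by apply: IH ad => t /andP[a't tb]; apply: fg; rewrite tb (le_trans (ltW aa')).
Qed.

Lemma adapted_chain f b a x c : adapted f b a (x :: c) -> chain_path d delta x c.
Proof.
elim: c x a => // y c IH x a [_ [a' [aa' fx ad]]]; rewrite /chain_path /=.
apply/andP; split; last exact: IH ad.
have <- : f a' = y by case: ad.
by apply: fx; rewrite lexx ltW.
Qed.

Definition replace f (q : R -> M) (a b : R) (t : R) : M :=
  if t <= a then f t else if t <= b then q t else f t.

Lemma replace_homotopic base f (q : R -> M) a b u : continuous f -> continuous q ->
  f 0 = base -> f 1 = base -> 0 <= a -> a < b -> b <= 1 -> q a = f a -> q b = f b ->
  (forall t, a <= t <= b -> d u (f t) < 2 * delta /\ d u (q t) < 2 * delta) ->
  let g := replace f q a b in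
  [/\ continuous g, g 0 = base, g 1 = base, loop_homotopic base f g
    & [/\ forall t, t <= a -> g t = f t, forall t, b <= t -> g t = f t
      & forall t, a <= t <= b -> g t = q t]].
Proof.
move=> cf cq f0 f1 a0 ab b1 qa qb dfq g.
have ga t : t <= a -> g t = f t by rewrite /g /replace => ->.
have gb t : b <= t -> g t = f t.
  move=> bt; rewrite /g /replace; case: ifPn => // _; case: ifPn => // tb.
  by have -> : t = b by apply/eqP; rewrite eq_le tb bt.
have gq t : a <= t <= b -> g t = q t.
  move=> /andP[at_ tb]; rewrite /g /replace tb; case: ifPn => // ta.
  by have -> : t = a by apply/eqP; rewrite eq_le at_ ta.
have cg : continuous g.
  apply: (@continuous_glue _ _ _ id) => //; first by move=> t; exact: cvg_id.
    apply: (@continuous_glue _ _ _ id) => //; first by move=> t; exact: cvg_id.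
    by move=> t ->.
  by move=> t ->; rewrite ltW.
split=> //; [by rewrite ga|by rewrite gb|].
have [B dB uB] := d_deformable u.
apply: (deformable_homotopic dB cf cg f0 f1 a0 (ltW ab) b1) => //.
- by move=> t /andP[_ ta]; rewrite ga.
- by move=> t /andP[bt _]; rewrite gb.
- move=> t tab; rewrite (gq _ tab); have [] := dfq t tab.
  by move=> /uB ? /uB.
Qed.

(* That [g] agrees with [f] before [a] makes it possible to prepend points to the
   chains. *)
Definition liftable base c c' := forall f a, continuous f -> f 0 = base -> f 1 = base ->
  0 <= a -> adapted f 1 a c -> exists g,
  [/\ continuous g, g 0 = base, g 1 = base, loop_homotopic base f g
    & (forall t, t <= a -> g t = f t) /\ adapted g 1 a c'].

Lemma liftable_cons base z y c y' c' :
  liftable base (y :: c) (y' :: c') -> liftable base (z :: y :: c) (z :: y' :: c').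
Proof.
move=> h f a cf f0 f1 a0 [fa [a' [aa' fz ad]]].
have a'0 : 0 <= a' by exact: le_trans (ltW aa').
have [g [cg g0 g1 fg [ga' adg]]] := h f a' cf f0 f1 a'0 ad.
exists g; split => //; split; first by move=> t ta; rewrite ga'// (le_trans ta)// ltW.
split; first by rewrite ga'// ltW.
exists a'; split => // t /andP[at_ ta']; rewrite ga'//.
by apply: fz; rewrite at_.
Qed.

Lemma liftable_cat base p y c y' c' :
  liftable base (y :: c) (y' :: c') -> liftable base (p ++ y :: c) (p ++ y' :: c').
Proof. by elim: p => // z [|w p] IH /IH; exact: liftable_cons. Qed.

Definition affine_path (p : R -> M) (a b t : R) : M := p ((t - a) / (b - a)).

Lemma affine_pathP (p : R -> M) a b : continuous p -> a < b ->
  [/\ continuous (affine_path p a b), affine_path p a b a = p 0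
    & affine_path p a b b = p 1].
Proof.
move=> cp ab; split.
- apply: continuous_compose cp => t.
  apply: cvgM; last exact: cvg_cst.
  by apply: cvgB; [exact: cvg_id|exact: cvg_cst].
- by rewrite /affine_path subrr mul0r.
- by rewrite /affine_path divff// subr_eq0 gt_eqF.
Qed.

Lemma double_ball u x y : d u x < delta -> d x y < delta -> d u y < 2 * delta.
Proof. by move=> ux xy; have := d_triangle u x y; lra. Qed.

Lemma double_ball1 u y : d u y < delta -> d u y < 2 * delta.
Proof. by move=> uy; have := d_ge0 u y; lra. Qed.

(** On the interval owned by [u], the loop is rerouted from [u] to [x] and then to [v]. The second
    half is within [delta] of [x], hence within 2 delta of [u]: this is why the deformable sets must
    contain balls of the double radius. *)
Lemma liftable_insert base u x v q : d u v < delta -> d u x < delta ->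
  d x v < delta -> liftable base (u :: v :: q) (u :: x :: v :: q).
Proof.
move=> uv ux xv f a cf f0 f1 a0 [fa [b [ab fu ad]]].
have b1 := @adapted_lt f 1 b (v :: q) ad; have fb : f b = v by case: ad.
have [p1 [cp1 p10 p11 dp1]] := d_path ux.
have [p2 [cp2 p20 p21 dp2]] := d_path xv.
pose m := (a + b) / 2.
have am : a < m by rewrite /m; lra.
have mb : m < b by rewrite /m; lra.
have [cq1 q1a q1m] := affine_pathP cp1 am.
have [cq2 q2m q2b] := affine_pathP cp2 mb.
pose r t := if t <= m then affine_path p1 a m t else affine_path p2 m b t.
have cr : continuous r.
  apply: (@continuous_glue _ _ _ id) => //; first by move=> t; exact: cvg_id.
  by move=> t ->; rewrite q1m q2m p11 p20.
have r1 t : t <= m -> r t = affine_path p1 a m t by rewrite /r => ->.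
have r2 t : m <= t -> r t = affine_path p2 m b t.
  move=> mt; rewrite /r; case: ifPn => // tm.
  have -> : t = m by apply/eqP; rewrite eq_le tm mt.
  by rewrite q1m q2m p11 p20.
have [||t tab|cg g0 g1 fg [ga gb gr]] :=
    @replace_homotopic base f r a b u cf cr f0 f1 a0 ab (ltW b1).
- by rewrite r1 ?(ltW am)// q1a p10 fa.
- by rewrite r2 ?(ltW mb)// q2b p21 fb.
- split; first exact/double_ball1/fu.
  have [tm|mt] := leP t m; first by rewrite r1//; exact/double_ball1/dp1.
  by rewrite r2 ?(ltW mt)//; apply: double_ball ux _; exact: dp2.
exists (replace f r a b); split => //; split => //=.
split; first by rewrite ga.
exists m; split => //.
  move=> t /andP[at_ tm]; rewrite gr; last by rewrite at_/= (le_trans tm)// ltW.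
  by rewrite r1//; exact: dp1.
split; first by rewrite gr ?(ltW am) ?(ltW mb)// r1// q1m.
exists b; split => //.
  move=> t /andP[mt tb]; rewrite gr; last by rewrite tb andbT (le_trans (ltW am)).
  by rewrite r2//; exact: dp2.
by refine (@adapted_ext f _ 1 b (v :: q) _ ad) => t /andP[bt _]; rewrite gb.
Qed.

(** The intervals owned by [u] and [x] are united; the loop stays within 2 delta of [u] there and is
    replaced by a path straight from [u] to [v]. *)
Lemma liftable_delete base u x v q : d u v < delta -> d u x < delta ->
  d x v < delta -> liftable base (u :: x :: v :: q) (u :: v :: q).
Proof.
move=> uv ux xv f a cf f0 f1 a0 [fa [m [am fu [fm [b [mb fx ad]]]]]].
have b1 := @adapted_lt f 1 b (v :: q) ad; have fb : f b = v by case: ad.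
have [p [cp p0 p1 dp]] := d_path uv.
have ab := lt_trans am mb.
have [cq qa qb] := affine_pathP cp ab.
have [||t /andP[at_ tb]|cg g0 g1 fg [ga gb gr]] :=
    @replace_homotopic base f (affine_path p a b) a b u cf cq f0 f1 a0 ab (ltW b1).
- by rewrite qa p0 fa.
- by rewrite qb p1 fb.
- split; last exact/double_ball1/dp.
  have [tm|mt] := leP t m; first by apply/double_ball1/fu; rewrite at_.
  by apply: double_ball ux _; apply: fx; rewrite tb ltW.
exists (replace f (affine_path p a b) a b); split => //; split => //=.
split; first by rewrite ga.
exists b; split => //; first by move=> t tab; rewrite gr//; exact: dp.
by refine (@adapted_ext f _ 1 b (v :: q) _ ad) => t /andP[bt _]; rewrite gb.
Qed.

(** The loop is kept, and [u] owns the union of the two adjacent intervals. *)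
Lemma liftable_undup base u q : liftable base (u :: u :: q) (u :: q).
Proof.
move=> f a cf f0 f1 a0 [fa [m [am fu ad]]].
exists f; split => //.
  have [B dB uB] := d_deformable base.
  (* Reflexivity of [loop_homotopic], as a deformation over the degenerate interval [0, 0]. *)
  apply: (deformable_homotopic dB cf cf f0 f1 (lexx 0) (lexx 0) ler01) => //.
  move=> t; rewrite -eq_le => /eqP <-; rewrite f0.
  by split; apply: uB; rewrite d_xx mulr_gt0.
split => //=; split => //; case: q ad => [|y q].
  move=> [fm [m1 fu']]; split; first exact: lt_trans m1.
  move=> t /andP[at_ t1]; have [tm|mt] := leP t m; first by apply: fu; rewrite at_.
  by apply: fu'; rewrite t1 ltW.
move=> [fm [b [mb fu' ad]]]; exists b; split => //; first exact: lt_trans mb.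
move=> t /andP[at_ tb]; have [tm|mt] := leP t m; first by apply: fu; rewrite at_.
by apply: fu'; rewrite tb ltW.
Qed.

Lemma liftable_dup base u q : liftable base (u :: q) (u :: u :: q).
Proof.
move=> f a cf f0 f1 a0 ad.
(* Here [b] is the right end of the interval owned by [u], which is 1 when [u] is the last point of
   the chain. *)
have [b [ab b1 fu adb]] : exists b, [/\ a < b, b <= 1,
    forall t, a <= t <= b -> d u (f t) < delta
    & (q = [::] /\ b = 1) \/ (q <> [::] /\ adapted f 1 b q)].
  case: q ad => [|y q] [fa].
    by move=> [a1 fu]; exists 1; split => //; left.
  move=> [b [ab fu ad]]; exists b; split => //; last by right.
  exact/ltW/(@adapted_lt f 1 b (y :: q) ad).
have fa : f a = u by case: (q) ad => [|? ?] [].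
pose m := (a + b) / 2.
have am : a < m by rewrite /m; lra.
have mb : m < b by rewrite /m; lra.
(* This path waits at [u] until [m] and then runs through [f] on [[a, b]] at double speed, so that
   [m] can start the interval of the second copy. *)
pose r t := f (clamp a b (a + (t - m) * 2)).
have cr : continuous r.
  apply: continuous_compose cf; apply: continuous_compose (@continuous_clamp _ _ _) => t.
  apply: cvgD; first exact: cvg_cst.
  apply: cvgM; last exact: cvg_cst.
  by apply: cvgB; [exact: cvg_id|exact: cvg_cst].
have ra t : t <= m -> r t = u.
  move=> tm; rewrite /r /clamp min_l; last by lra.
  by rewrite max_l//; lra.
have ur t : d u (r t) < delta by apply: fu; exact: clamp_itv (ltW ab).
have [||t tab|cg g0 g1 fg [ga gb gr]] :=
    @replace_homotopic base f r a b u cf cr f0 f1 a0 ab b1.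
- by rewrite ra// ltW.
- by rewrite /r; congr f; rewrite /clamp min_r; [rewrite max_r// ltW|rewrite /m; lra].
- by split; apply: double_ball1; [exact: fu|exact: ur].
exists (replace f r a b); split => //; split => //=.
split; first by rewrite ga.
exists m; split => //.
  move=> t /andP[at_ tm]; rewrite gr; last by rewrite at_/= (le_trans tm)// ltW.
  exact: ur.
have gm : replace f r a b m = u by rewrite gr ?(ltW am) ?(ltW mb)// ra.
split => //; case: adb => [[-> b1']|[qn adb]].
  subst b; split => // t /andP[mt tb]; rewrite gr ?tb ?(le_trans (ltW am))//.
have : exists b0, [/\ m < b0, forall t, m <= t <= b0 -> d u (replace f r a b t) < delta
    & adapted (replace f r a b) 1 b0 q].
  exists b; split => //.
    move=> t /andP[mt tb]; rewrite gr; last by rewrite tb andbT (le_trans (ltW am)).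
    exact: ur.
  by apply: adapted_ext adb => t /andP[bt _]; rewrite gb.
by case: (q) qn.
Qed.

(** Both directions are proved at once because [chain_homotopic] is closed under symmetry. *)
Lemma chain_homotopic_lift base c c' : chain_homotopic d delta c c' ->
  liftable base c c' /\ liftable base c' c.
Proof.
have lrefl c0 : liftable base c0 c0.
  move=> f a cf f0 f1 a0 ad; exists f; split => //.
  have [B dB uB] := d_deformable base.
  apply: (deformable_homotopic dB cf cf f0 f1 (lexx 0) (lexx 0) ler01) => //.
  move=> t; rewrite -eq_le => /eqP <-; rewrite f0.
  by split; apply: uB; rewrite d_xx mulr_gt0.
have ltrans c1 c2 c3 : liftable base c1 c2 -> liftable base c2 c3 -> liftable base c1 c3.
  move=> h12 h23 f a cf f0 f1 a0 ad.
  have [g [cg g0 g1 fg [ga adg]]] := h12 f a cf f0 f1 a0 ad.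
  have [h [ch h0 h1 gh [ha adh]]] := h23 g a cg g0 g1 a0 adg.
  exists h; split => //; first exact: loop_homotopic_trans gh.
  by split => // t ta; rewrite ha// ga.
elim=> {c c'} [c|c c' _ [h h']|c c' c'' _ [h h'] _ [k k']|p u x v q uv ux xv|p u q].
- by split.
- by split.
- by split; [exact: ltrans k|exact: ltrans h'].
- by split; apply: liftable_cat; [exact: liftable_insert|exact: liftable_delete].
- by split; apply: liftable_cat; [exact: liftable_dup|exact: liftable_undup].
Qed.

(** Lifting the homotopy of chains ends with a loop adapted to the single point [base], which
    therefore stays in one deformable set. *)
Lemma adapted_null base c f : continuous f -> f 0 = base -> f 1 = base ->
  adapted f 1 0 (base :: c) -> chain_null d delta base c ->
  loop_homotopic base f (cst base).
Proof.
move=> cf f0 f1 ad /(chain_homotopic_lift base)[lift _].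
have [g [cg g0 g1 fg [_ [_ [_ gbase]]]]] := lift f 0 cf f0 f1 (lexx 0) ad.
apply: loop_homotopic_trans fg _.
have [B dB uB] := d_deformable base.
apply: (deformable_homotopic dB cg _ g0 g1 (lexx 0) ler01 (lexx 1)) => //.
- by move=> t; exact: cvg_cst.
- by move=> t; rewrite -eq_le => /eqP <-.
- by move=> t; rewrite -eq_le => /eqP <-.
- move=> t t01; split; apply: uB; first exact/double_ball1/gbase.
  by rewrite d_xx mulr_gt0.
Qed.

(** Cousin's lemma for the property of [[u, v]] that some [xs] can be prepended to every chain
    adapted from [v] on; quantifying over the rest of the chain makes it additive. An interval on
    which [f] stays within [delta / 2] of a value needs only its left end as a new point. *)
Lemma exists_adapted f a b b' ys : continuous f -> a <= b ->
  adapted f b' b ys -> exists xs, adapted f b' a (xs ++ ys).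
Proof.
move=> cf ab ad.
have : exists xs, forall ys b', adapted f b' b ys -> adapted f b' a (xs ++ ys).
  apply: (@interval_local_to_global R (fun u v => exists xs,
    forall ys b', adapted f b' v ys -> adapted f b' u (xs ++ ys))) => //.
    move=> u t v _ _ [xs h] [xs' h']; exists (xs ++ xs') => zs b0 adz.
    by rewrite -catA; apply: h; apply: h'.
  move=> t _.
  have := cf t _ (d_nbhs (f t) (_ : 0 < delta / 2)).
  rewrite divr_gt0// => /(_ isT)/nbhs_ballP[e /= e0 He].
  exists e => // u v /andP[_ ut] /andP[tv _] tu vt.
  have [uv|vu] := ltP u v; last first.
    have -> : u = v by lra.
    by exists [::].
  exists [:: f u] => zs b0 /= adz; case: zs adz => // z zs adz; split => //.
  exists v; split => // w /andP[uw wv].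
  have wt : d (f t) (f w) < delta / 2.
    by apply: He; rewrite /ball/= ltr_norml; apply/andP; lra.
  have ut' : d (f t) (f u) < delta / 2.
    by apply: He; rewrite /ball/= ltr_norml; apply/andP; lra.
  by have := d_triangle (f u) (f t) (f w); rewrite (d_sym (f u) (f t)); lra.
by move=> [xs h]; exists xs; exact: h.
Qed.

Lemma essential_loop_lengths base f : loops base f ->
  ~ loop_homotopic base f (cst base) -> essential_lengths d delta !=set0.
Proof.
move=> [cf f0 f1] nf.
(* Staying at the base point after time 1/2 gives the last point of the chain a
   nondegenerate interval. *)
pose g t := f (clamp01 (2 * t)).
have cg : continuous g.
  have cfc : continuous (f \o clamp01).
    apply: (continuous_within_comp cf); first exact: continuous_clamp.
    by move=> t; rewrite /= in_itv/= clamp01_itv.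
  apply: continuous_compose cfc => t.
  by apply: cvgM; [exact: cvg_cst|exact: cvg_id].
have c0 : clamp01 0 = 0 by apply: clamp_id; rewrite lexx ler01.
have c1 t : 1 <= t -> clamp01 t = 1.
  by move=> t1; rewrite /clamp min_r// max_r.
have g0 : g 0 = base by rewrite /g mulr0 c0.
have g1 t : 1 / 2 <= t -> g t = base by move=> t1; rewrite /g c1//; lra.
have fg : loop_homotopic base f g.
  exists ((f \o clamp01) \o (fun p : R * R => (1 + p.1) * p.2)); split.
  - apply: continuous_subspaceT; apply: continuous_compose.
      move=> p; apply: cvgM; last exact: cvg_snd.
      by apply: cvgD; [exact: cvg_cst|exact: cvg_fst].
    apply: (continuous_within_comp cf); first exact: continuous_clamp.
    by move=> t; rewrite /= in_itv/= clamp01_itv.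
  - by move=> t; rewrite in_itv/= => t01; rewrite addr0 mul1r clamp_id.
  - by move=> t _ /=; rewrite /g; congr (f (clamp01 _)); ring.
  - move=> s; rewrite in_itv/= => /andP[s0 s1]; rewrite mulr0 mulr1 c0 c1//.
    by lra.
have adh : adapted g 1 (1 / 2) [:: base].
  split; first by rewrite g1.
  split; first by lra.
  by move=> t /andP[t1 _]; rewrite g1// d_xx.
have h0 : (0 : R) <= 1 / 2 by lra.
have [xs ad] := exists_adapted cg h0 adh.
have [c xsE] : exists c, xs ++ [:: base] = base :: c.
  case: xs ad => [|x xs] ad; first by exists [::].
  by exists (xs ++ [:: base]); case: ad => <- _; rewrite g0.
move: ad; rewrite xsE => ad.
exists (chain_length d base c), base, c; split => //; first exact: adapted_chain ad.
  by have := congr1 (last base) xsE; rewrite last_cat.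
move=> nc; apply: nf; apply: loop_homotopic_trans fg _.
by apply: adapted_null ad nc => //; rewrite g1//; lra.
Qed.

End LoopHomotopy.

Lemma subrACA (V : zmodType) (a b c d : V) : (a - b) - (c - d) = (a - c) - (b - d).
Proof. by rewrite !opprB [d - c]addrC addrACA [- b + d]addrC. Qed.

Lemma sub_chain (V : zmodType) (a b c p q : V) :
  c - a - (p + q) = (b - a - p) + (c - b - q).
Proof. by rewrite opprD [RHS]addrACA [b - a + _]addrC [c - b + _]addrA subrK. Qed.

(** * One-sided derivatives *)

Section OneSidedDerivative.
Variable R : realType.
Implicit Types (V W : normedModType R) (A : set R).

(** Stated without a quotient, the expansion makes no exception of [u = t], and passing to a smaller
    set or a nearby function only shrinks [d]. *)
Definition has_derive_within {V} A (f : R -> V) (t : R) (l : V) :=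
  forall e : R, 0 < e -> exists2 d : R, 0 < d & forall u, A u -> `|u - t| < d ->
    `|f u - f t - (u - t) *: l| <= e * `|u - t|.

Lemma near_within_dnbhsP A (t : R) (P : set R) :
  (\forall u \near within A t^', P u) <->
  exists2 d : R, 0 < d & forall u, `|u - t| < d -> u != t -> A u -> P u.
Proof.
split=> [/nbhs_ballP[d /= d0 H]|[d d0 H]].
  by exists d => // u ud ut Au; apply: H => //; rewrite /ball/= distrC.
apply/nbhs_ballP; exists d => //= u; rewrite /ball/= distrC => ud ut Au.
exact: H.
Qed.

Lemma diffquot_cvgP {V} A (f : R -> V) t l :
  (diffquot f t @ within A t^' --> l) <-> has_derive_within A f t l.
Proof.
have normE u : u != t ->
    `|f u - f t - (u - t) *: l| = `|l - diffquot f t u| * `|u - t|.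
  move=> ut; rewrite distrC mulrC -normrZ /diffquot scalerBr scalerA.
  by rewrite divff ?subr_eq0// scale1r.
split=> [/cvgrPdist_le cvl e e0|h].
  have /near_within_dnbhsP[d d0 H] := cvl e e0; exists d => // u Au ud.
  have [->|ut] := eqVneq u t; first by rewrite !subrr scale0r subrr !normr0 mulr0.
  by rewrite normE// ler_wpM2r//; exact: H.
apply/cvgrPdist_le => e e0; have [d d0 H] := h e e0.
apply/near_within_dnbhsP; exists d => // u ud ut Au.
by have := H u Au ud; rewrite normE// ler_pM2r// normr_gt0 subr_eq0.
Qed.

Lemma within_dnbhs_proper (a b t : R) : a < b -> a <= t <= b ->
  ProperFilter (within `[a, b] t^').
Proof.
move=> ab /andP[at_ tb]; apply: Build_ProperFilter => /near_within_dnbhsP[d d0 H].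
have [tltb|] := ltP t b.
  pose u := t + Order.min d (b - t) / 2.
  have m0 : 0 < Order.min d (b - t) by rewrite lt_min d0 subr_gt0.
  have m1 : Order.min d (b - t) <= d by rewrite ge_min lexx.
  have m2 : Order.min d (b - t) <= b - t by rewrite ge_min lexx orbT.
  apply: (H u); rewrite /u.
  - by rewrite ltr_norml; apply/andP; lra.
  - by apply/eqP; lra.
  - by rewrite /= in_itv/=; apply/andP; lra.
move=> bt; pose u := t - Order.min d (b - a) / 2.
have m0 : 0 < Order.min d (b - a) by rewrite lt_min d0 subr_gt0.
have m1 : Order.min d (b - a) <= d by rewrite ge_min lexx.
have m2 : Order.min d (b - a) <= b - a by rewrite ge_min lexx orbT.
apply: (H u); rewrite /u.
- by rewrite ltr_norml; apply/andP; lra.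
- by apply/eqP; lra.
- by rewrite /= in_itv/=; apply/andP; lra.
Qed.

Lemma has_derive_within_derive {V} (a b t : R) (f : R -> V) l : a < b ->
  a <= t <= b -> has_derive_within `[a, b] f t l ->
  derivable_within `[a, b] f t /\ derive_within `[a, b] f t = l.
Proof.
move=> ab tab /diffquot_cvgP h; have pf := within_dnbhs_proper ab tab.
by split; [apply/cvg_ex; exists l|apply: cvg_lim h; exact: norm_hausdorff].
Qed.

Lemma has_derive_withinS {V} A B (f : R -> V) t l : A `<=` B ->
  has_derive_within B f t l -> has_derive_within A f t l.
Proof.
by move=> AB h e e0; have [d d0 H] := h e e0; exists d => // u /AB; exact: H.
Qed.

Lemma has_derive_within_near {V} A B (f : R -> V) t l r : 0 < r ->
  (forall u, `|u - t| < r -> A u -> B u) ->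
  has_derive_within B f t l -> has_derive_within A f t l.
Proof.
move=> r0 AB h e e0; have [d d0 H] := h e e0.
exists (Order.min d r); first by rewrite lt_min d0.
by move=> u Au; rewrite lt_min => /andP[ud ur]; apply: H => //; exact: AB.
Qed.

Lemma has_derive_within_interior {V} (f : R -> V) a b t l :
  a < t < b -> has_derive_within `[a, b] f t l -> has_derive_within setT f t l.
Proof.
move=> /andP[at_ tb].
apply: (@has_derive_within_near _ _ _ _ _ _ (Order.min (t - a) (b - t))).
  by rewrite lt_min subr_gt0 at_/= subr_gt0.
move=> w; rewrite lt_min => /andP[w1 w2] _; rewrite /= in_itv/=.
by move: w1 w2; rewrite !ltr_norml => /andP[? ?] /andP[? ?]; apply/andP; lra.
Qed.

Lemma eq_has_derive_within {V} A (f g : R -> V) t l : A t ->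
  (forall u, A u -> f u = g u) ->
  has_derive_within A f t l -> has_derive_within A g t l.
Proof.
move=> At fg h e e0; have [d d0 H] := h e e0; exists d => // u Au.
by rewrite -!fg//; exact: H.
Qed.

Lemma near_eq_has_derive_within {V} A (f g : R -> V) t l : A t ->
  (\forall u \near within A (nbhs t), f u = g u) ->
  has_derive_within A f t l -> has_derive_within A g t l.
Proof.
move=> At /nbhs_ballP[r /= r0 fg] h e e0; have [d d0 H] := h e e0.
exists (Order.min d r); first by rewrite lt_min d0.
move=> u Au; rewrite lt_min => /andP[ud ur].
rewrite -!fg//; first exact: H.
- by rewrite /ball/= subrr normr0.
- by rewrite /ball/= distrC.
Qed.

Lemma slope_cvgP {V} (g : R -> V) s l :
  ((fun h : R => h^-1 *: (g (h + s) - g s)) @ (0 : R)^' --> l) <->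
  has_derive_within setT g s l.
Proof.
have normE h : h != 0 ->
    `|g (h + s) - g s - h *: l| = `|l - h^-1 *: (g (h + s) - g s)| * `|h|.
  move=> h0; rewrite distrC mulrC -normrZ scalerBr scalerA.
  by rewrite divff// scale1r.
have wT : within setT (0 : R)^' = (0 : R)^'.
  apply/funext => P; rewrite /within/=; apply/propext.
  by split; apply: filterS => x; [exact|move=> ? _].
rewrite -wT; split=> [/cvgrPdist_le cvl e e0|h].
  have /near_within_dnbhsP[d d0 H] := cvl e e0; exists d => // u _ ud.
  have [->|ut] := eqVneq u s; first by rewrite !subrr scale0r subrr !normr0 mulr0.
  have us0 : u - s != 0 by rewrite subr_eq0.
  have := normE _ us0; rewrite subrK => ->; rewrite ler_wpM2r//.
  by have := H (u - s); rewrite subr0 subrK; apply.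
apply/cvgrPdist_le => e e0; have [d d0 H] := h e e0.
apply/near_within_dnbhsP; exists d => // u; rewrite subr0 => ud u0 _.
have := H (u + s) I; rewrite addrK => /(_ ud).
by rewrite normE// ler_pM2r// normr_gt0.
Qed.

Lemma derivable_slopeP {V} (f : R -> V) t l :
  (derivable f t 1 /\ derive1 f t = l) <-> has_derive_within setT f t l.
Proof.
have E : (fun h : R => h^-1 *: ((f \o shift t) (h *: (1 : R)) - f t)) =
    (fun h => h^-1 *: (f (h + t) - f t)).
  by apply/funext => h /=; rewrite /GRing.scale/= mulr1.
rewrite -slope_cvgP /derivable E /derive1; split.
  by move=> [/cvg_ex[/= k hk] <-]; rewrite (cvg_lim _ hk)//; exact: norm_hausdorff.
move=> h; split; first by apply/cvg_ex; exists l.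
by apply: cvg_lim h; exact: norm_hausdorff.
Qed.

Lemma derivable_line {V W} (f : V -> W) (x v : V) (s : R) :
  derivable f (x + s *: v) v ->
  has_derive_within setT (fun s => f (x + s *: v)) s ('D_v f (x + s *: v)).
Proof.
move=> df; apply/slope_cvgP; rewrite /derive.
have E : (fun h : R => h^-1 *: ((f \o shift (x + s *: v)) (h *: v) - f (x + s *: v))) =
  (fun h => h^-1 *: (f (x + (h + s) *: v) - f (x + s *: v))).
  by apply/funext => h /=; rewrite scalerDl addrCA.
by rewrite -E.
Qed.

(** Rolle's theorem fails for vector values. The estimate with slope [e + r] is additive over
    adjacent intervals and holds on small intervals around each [t] by differentiability there, so
    Cousin's lemma gives it on [[a, b]]; then [r] tends to 0. *)
Lemma mean_value_le {V} (f df : R -> V) (L : V) (a b e : R) : a <= b -> 0 <= e ->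
  (forall t, a <= t <= b ->
    has_derive_within `[a, b] f t (df t) /\ `|df t - L| <= e) ->
  `|f b - f a - (b - a) *: L| <= e * (b - a).
Proof.
move=> ab e0 h; suff H r : 0 < r -> `|f b - f a - (b - a) *: L| <= (e + r) * (b - a).
  apply/ler_addgt0Pr => r r0; have [ba|ab'] := leP b a.
    have -> : b = a by lra.
    by rewrite !subrr scale0r subrr !normr0 mulr0 add0r ltW.
  have ba0 : 0 < b - a by lra.
  by have := H (r / (b - a)) (divr_gt0 r0 ba0); rewrite mulrDl divfK// gt_eqF.
move=> r0.
apply: (@interval_local_to_global R (fun u v =>
  `|f v - f u - (v - u) *: L| <= (e + r) * (v - u))) => //.
  move=> u t v _ _ ut tv.
  have -> : f v - f u - (v - u) *: L =
      (f t - f u - (t - u) *: L) + (f v - f t - (v - t) *: L).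
    have -> : v - u = (t - u) + (v - t) by ring.
    by rewrite scalerDl; exact: sub_chain.
  by apply: le_trans (ler_normD _ _) _; lra.
move=> t tab; have [hd dL] := h t tab; have [d d0 H] := hd r r0.
exists d => // u v /andP[au ut] /andP[tv vb] tdu vtd.
have hv : `|f v - f t - (v - t) *: df t| <= r * (v - t).
  have := H v; rewrite /= in_itv/= (ger0_norm (_ : 0 <= v - t)) ?subr_ge0//; apply.
    by rewrite vb andbT; lra.
  lra.
have hu : `|f u - f t - (u - t) *: df t| <= r * (t - u).
  have := H u; rewrite /= in_itv/= distrC (ger0_norm (_ : 0 <= t - u)) ?subr_ge0//; apply.
    by rewrite au/=; lra.
  lra.
have -> : f v - f u - (v - u) *: L = (f v - f t - (v - t) *: df t) -
    (f u - f t - (u - t) *: df t) + (v - u) *: (df t - L).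
  rewrite (subrACA (f v - f t)) (subrACA (f v)) subrr subr0 -scalerBl.
  have -> : v - t - (u - t) = v - u by ring.
  by rewrite scalerBr addrA subrK.
apply: le_trans (ler_normD _ _) _; rewrite normrZ.
apply: le_trans (lerD (ler_normB _ _) (lexx _)) _.
have -> : `|v - u| = v - u by rewrite ger0_norm// subr_ge0 (le_trans ut).
have : (v - u) * `|df t - L| <= (v - u) * e by rewrite ler_wpM2l// subr_ge0 (le_trans ut).
lra.
Qed.

Lemma mean_value_line_le {V W} (f : V -> W) (x v : V) (L : W) (r e : R) : 0 <= e ->
  (forall s, `|s| <= `|r| -> derivable f (x + s *: v) v /\
     `|'D_v f (x + s *: v) - L| <= e) ->
  `|f (x + r *: v) - f x - r *: L| <= e * `|r|.
Proof.
move=> e0 h; pose phi s := f (x + s *: v).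
have hphi s : `|s| <= `|r| ->
    has_derive_within setT phi s ('D_v f (x + s *: v)) /\
    `|'D_v f (x + s *: v) - L| <= e.
  by move=> /h[ds dL]; split => //; exact: derivable_line.
have fx : f x = phi 0 by rewrite /phi scale0r addr0.
have [r0|r0] := leP 0 r.
  have := @mean_value_le _ phi (fun s => 'D_v f (x + s *: v)) L 0 r e r0 e0.
  rewrite subr0 fx (ger0_norm r0); apply=> t /andP[t0 tr].
  have [|hd dL] := hphi t; first by rewrite !ger0_norm.
  by split => //; exact: has_derive_withinS hd.
have := @mean_value_le _ phi (fun s => 'D_v f (x + s *: v)) L r 0 e (ltW r0) e0.
rewrite sub0r fx (ltr0_norm r0) -normrN.
have -> : - (phi 0 - phi r - - r *: L) = phi r - phi 0 - r *: L.
  by rewrite scaleNr opprK opprD opprB.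
apply=> t /andP[rt t0].
have [|hd dL] := hphi t; first by rewrite !ler0_norm ?lerN2// ltW.
by split => //; exact: has_derive_withinS hd.
Qed.

End OneSidedDerivative.

(** * Continuous partial derivatives imply differentiability *)

Section ContinuousPartialDerivatives.
Variables (R : realType) (n : nat) (W : normedModType R).

Definition row_lincomb (w : 'I_n -> W) (h : 'rV[R]_n) : W :=
  \sum_i h 0 i *: w i.

Lemma row_lincomb_linear w : linear (row_lincomb w).
Proof.
move=> a u v; rewrite /row_lincomb scaler_sumr -big_split; apply: eq_bigr => i _.
by rewrite !mxE scalerDl scalerA.
Qed.

HB.instance Definition _ w :=
  GRing.isLinear.Build R 'rV[R]_n W *:%R (row_lincomb w) (row_lincomb_linear w).

Lemma row_lincomb_continuous w : continuous (row_lincomb w).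
Proof.
apply: continuous_big => [|i _ h].
  by move=> p; apply: cvgD; [exact: cvg_fst|exact: cvg_snd].
have ci : (fun x : 'rV[R]_n => x 0 i) x @[x --> h] --> h 0 i.
  exact: (@coord_continuous R 1 n 0 i h).
exact: (cvgZ ci (cvg_cst (w i))).
Qed.

Lemma rV_norm_coord (v : 'rV[R]_n) i : `|v 0 i| <= `|v|.
Proof.
rewrite [leRHS]/Num.norm /= mx_normrE; apply/bigmax_geP; right => /=.
by exists (0, i).
Qed.

Lemma rV_norm_le (v : 'rV[R]_n) c : 0 <= c -> (forall i, `|v 0 i| <= c) -> `|v| <= c.
Proof.
move=> c0 h; rewrite [leLHS]/Num.norm /= mx_normrE; apply/bigmax_leP; split => //.
by move=> [i j] _ /=; rewrite ord1.
Qed.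

(** The increment is cut into [n] steps parallel to the axes: [pt k] has moved in the first [k]
    coordinates only. For the maximum norm, all these steps remain in the ball of radius [r]. *)
Lemma row_lincomb_approx (f : 'rV[R]_n -> W) (x : 'rV[R]_n) (r e : R) : 0 <= e ->
  (forall y, `|y - x| < r -> forall i : 'I_n, derivable f y (delta_mx 0 i) /\
    `|'D_(delta_mx 0 i) f y - 'D_(delta_mx 0 i) f x| <= e) ->
  forall h, `|h| < r ->
  `|f (x + h) - f x - row_lincomb (fun i => 'D_(delta_mx 0 i) f x) h| <=
  e * n%:R * `|h|.
Proof.
move=> e0 df h hr.
pose pt k : 'rV[R]_n := x + \row_i (if (i < k)%N then h 0 i else 0).
pose D i := 'D_(delta_mx 0 i) f x.
suff H k : (k <= n)%N -> `|f (pt k) - f x - \sum_(i < n | (i < k)%N) h 0 i *: D i| <=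
    e * k%:R * `|h|.
  have := H n (leqnn n).
  have -> : pt n = x + h.
    by congr (x + _); apply/rowP => i; rewrite mxE ltn_ord.
  rewrite (eq_bigl xpredT)// => i; exact: ltn_ord.
elim: k => [_|k IH kn].
  rewrite big_pred0// subr0.
  have -> : pt 0%N = x.
    by rewrite -[RHS]addr0; congr (x + _); apply/rowP => i; rewrite !mxE.
  by rewrite subrr !normr0 mulr0 mul0r.
pose ik := Ordinal kn.
have ptS : pt k.+1 = pt k + h 0 ik *: delta_mx 0 ik.
  rewrite /pt -addrA; congr (x + _); apply/rowP => i; rewrite !mxE eqxx/=.
  rewrite ltnS leq_eqVlt -val_eqE /=; case: eqVneq => [ki|_].
    by rewrite ki ltnn add0r mulr1; congr (h 0 _); apply: val_inj.
  by rewrite mulr0 addr0.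
have -> : \sum_(i < n | (i < k.+1)%N) h 0 i *: D i =
    \sum_(i < n | (i < k)%N) h 0 i *: D i + h 0 ik *: D ik.
  rewrite (bigD1 ik) ?ltnSn//= addrC; congr (_ + _); apply: eq_bigl => i.
  by rewrite ltnS leq_eqVlt -val_eqE /=; case: eqVneq => [->|_]; rewrite ?ltnn ?andbF ?andbT.
have step : `|f (pt k.+1) - f (pt k) - h 0 ik *: D ik| <= e * `|h 0 ik|.
  rewrite ptS; apply: mean_value_line_le => // s sh; apply: df.
  apply: le_lt_trans hr; apply: rV_norm_le => // i.
  rewrite /pt addrAC [x + _]addrC addrK !mxE eqxx/=.
  case: eqVneq => [->|ik'].
    by rewrite ltnn add0r mulr1 (le_trans sh)// rV_norm_coord.
  by rewrite mulr0 addr0; case: ifP => _; rewrite ?normr0// rV_norm_coord.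
have -> : f (pt k.+1) - f x - (\sum_(i < n | (i < k)%N) h 0 i *: D i + h 0 ik *: D ik) =
    (f (pt k) - f x - \sum_(i < n | (i < k)%N) h 0 i *: D i) +
    (f (pt k.+1) - f (pt k) - h 0 ik *: D ik).
  exact: sub_chain.
apply: le_trans (ler_normD _ _) _; rewrite -natr1 mulrDr mulr1 mulrDl.
apply: lerD; first exact/IH/ltnW.
by apply: le_trans step _; rewrite ler_wpM2l// rV_norm_coord.
Qed.

(** [smooth_on] provides directional derivatives, whereas changing the chart along a curve takes the
    chain rule, hence a total derivative of the transition map. *)
Lemma continuous_partials_differentiable (U : set 'rV[R]_n) (f : 'rV[R]_n -> W) x :
  open U -> U x -> smooth_on U f -> differentiable f x.
Proof.
move=> oU Ux sf; pose L : {linear 'rV[R]_n -> W} := row_lincomb (fun i => 'D_(delta_mx 0 i) f x).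
have approx : forall e : R, 0 < e -> exists2 r, 0 < r & forall h, `|h| < r ->
    `|f (x + h) - f x - L h| <= e * `|h|.
  (* Each of the [n] coordinates contributes [e']; the successor avoids a division by zero in
     dimension 0. *)
  move=> e e0; pose e' := e / n.+1%:R.
  have e'0 : 0 < e' by rewrite divr_gt0.
  have : \forall y \near x, U y /\ forall i : 'I_n,
      `|'D_(delta_mx 0 i) f y - 'D_(delta_mx 0 i) f x| <= e'.
    apply: filterI; first exact: open_nbhs_nbhs.
    have near_i (i : 'I_n) : \forall y \near x,
        `|'D_(delta_mx 0 i) f y - 'D_(delta_mx 0 i) f x| <= e'.
      have [ci _] := sf [:: delta_mx 0 i] x Ux.
      by have := ci; rewrite /continuous_at /= => /cvgrPdistC_le; exact.
    exact: (@filter_forall _ _ (fun i y =>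
      `|'D_(delta_mx 0 i) f y - 'D_(delta_mx 0 i) f x| <= e') (nbhs x) _ near_i).
  move=> /nbhs_ballP[r /= r0 H]; exists r => // h hr.
  apply: le_trans (row_lincomb_approx (ltW e'0) _ hr) _.
    move=> y yx i; have [|Uy /(_ i) Dy] := H y.
      by rewrite -ball_normE /= distrC.
    by split => //; have [_ /(_ (delta_mx 0 i))] := sf [::] y Uy.
  rewrite ler_wpM2r// /e' -mulrA ler_piMr ?(ltW e0)//.
  by rewrite mulrC ler_pdivrMr// mul1r ler_nat.
(* The differential is chosen among the continuous linear maps that give a first-order expansion, so
   it suffices to exhibit one. *)
apply/diffP; apply: (@getPex _ (fun df : {linear 'rV[R]_n -> W} => continuous df /\
  forall y, f y = f (lim (nbhs x)) + df (y - lim (nbhs x))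
    +o_(y \near x) (y - lim (nbhs x)))).
exists L; split; first exact: row_lincomb_continuous.
have fE : f = (fun y => f x + L (y - x)) +o_ x (fun y => y - x).
  apply/eqaddoP => e e0; have [r r0 H] := approx e e0.
  apply/nbhs_ballP; exists r => // y; rewrite -ball_normE /= distrC => yx.
  have := H _ yx; rewrite [x + _]addrC subrK.
  by rewrite -[(f - _) y]/(f y - (f x + L (y - x))) opprD addrA.
move=> y; rewrite lim_id//.
exact: (congr1 (@^~ y) fE).
Qed.

End ContinuousPartialDerivatives.

(** * Curves in charts *)

Section Charts.
Variables (R : realType) (n : nat) (M : topologicalType).
Implicit Types (c : chart R n M) (A : smooth_atlas R n M).

Lemma chart_map_at c x : chart_dom c x -> {for x, continuous c}.
Proof.
move=> dx; have := @chart_map_continuous _ _ _ c.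
rewrite continuous_open_subspace; last exact: chart_dom_open.
by apply; exact: mem_set.
Qed.

Lemma chart_inv_at c z : (c @` chart_dom c) z -> {for z, continuous (chart_inv c)}.
Proof.
move=> dz; have := @chart_inv_continuous _ _ _ c.
rewrite continuous_open_subspace; last exact: chart_img_open.
by apply; exact: mem_set.
Qed.

Lemma chart_invK c x : chart_dom c x -> chart_inv c (c x) = x.
Proof. by move=> dx; apply: chart_mapK; exact: mem_set. Qed.

Lemma chart_imgP c z : (c @` chart_dom c) z ->
  chart_dom c (chart_inv c z) /\ c (chart_inv c z) = z.
Proof. by move=> [y dy <-]; rewrite chart_invK. Qed.

Lemma nbhs_chart_dom c x : chart_dom c x -> nbhs x (chart_dom c).
Proof. by move=> dx; apply: open_nbhs_nbhs; split => //; exact: chart_dom_open. Qed.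

Lemma nbhs_chart_img c x : chart_dom c x -> nbhs (c x) (c @` chart_dom c).
Proof.
move=> dx; apply: open_nbhs_nbhs; split; first exact: chart_img_open.
by exists x.
Qed.

Lemma open_transition_dom c c' : open (c @` (chart_dom c `&` chart_dom c')).
Proof.
rewrite openE => _ [x [dx dx'] <-]; rewrite /interior.
have ci : {for c x, continuous (chart_inv c)}.
  by apply: chart_inv_at; exists x.
have near_dom' : \forall z \near c x, chart_dom c' (chart_inv c z).
  by apply: ci; rewrite chart_invK//; exact: nbhs_chart_dom.
apply: filterS2 near_dom' (nbhs_chart_img dx) => z dz' /chart_imgP[dz zE].
by exists (chart_inv c z).
Qed.

Lemma transition_differentiable A c c' x : atlas_charts A c -> atlas_charts A c' ->
  chart_dom c x -> chart_dom c' x -> differentiable (transition c c') (c x).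
Proof.
move=> Ac Ac' dx dx'.
apply: (continuous_partials_differentiable (@open_transition_dom c c')).
  by exists x.
exact: (atlas_smooth Ac Ac').
Qed.

Lemma chart_at_atlas A x : atlas_charts A (chart_at A x).
Proof. exact: (projT2 (cid (atlas_cover A x))).1. Qed.

Lemma chart_at_dom A x : chart_dom (chart_at A x) x.
Proof. exact: (projT2 (cid (atlas_cover A x))).2. Qed.

Variables (A : smooth_atlas R n M) (g : riemannian_metric A).

Definition metric_norm c (y : M) (v : 'rV[R]_n) : R :=
  Num.sqrt ((v *m metric_mx g c y *m v^T) 0 0).

(** [speed] uses the chart [chart_at A (gam t)], which may jump with [t]; a fixed chart around a
    point is what gives continuity of the speed. The Jacobian of the transition, which transforms
    the velocity, is absorbed by [metric_mx_change]. *)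
Lemma speed_chart (gam : R -> M) t c v : atlas_charts A c -> chart_dom c (gam t) ->
  {for t, continuous gam} -> has_derive_within setT (c \o gam) t v ->
  speed g gam t = metric_norm c (gam t) v.
Proof.
move=> Ac dc cgam /derivable_slopeP[dv dvE].
set c' := chart_at A (gam t).
have Ac' : atlas_charts A c' := chart_at_atlas A (gam t).
have dc' : chart_dom c' (gam t) := chart_at_dom A (gam t).
have dT := transition_differentiable Ac Ac' dc dc'.
have dcg : differentiable (c \o gam) t by exact/derivable1_diffP.
have dTcg : differentiable (transition c c' \o (c \o gam)) t.
  exact: differentiable_comp.
have h : has_derive_within setT (transition c c' \o (c \o gam)) t
    (v *m 'J (transition c c') (c (gam t))).
  apply/derivable_slopeP; split; first exact/derivable1_diffP.
  rewrite derive1E' // diff_comp //= -(derive1E' dcg) dvE.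
  by rewrite /jacobian mul_rV_lin1.
have : has_derive_within setT (c' \o gam) t
    (v *m 'J (transition c c') (c (gam t))).
  apply: near_eq_has_derive_within h => //.
  have : \forall u \near t, chart_dom c (gam u) by apply: cgam; exact: nbhs_chart_dom.
  by apply: filterS => u du _ /=; rewrite /transition /= chart_invK.
move=> /derivable_slopeP[_ dE].
rewrite /speed -/c' dE /metric_norm; congr (Num.sqrt (fun_of_matrix _ 0 0)).
by rewrite (metric_mx_change g Ac Ac' dc dc') trmx_mul !mulmxA.
Qed.

Lemma metric_mx_at c y : atlas_charts A c -> chart_dom c y ->
  {for y, continuous (metric_mx g c)}.
Proof.
move=> Ac dy.
have ch : {for c y, continuous (metric_mx g c \o chart_inv c)}.
  by have [] := @metric_mx_smooth _ _ _ _ g c Ac [::] (c y) (ex_intro2 _ _ y dy erefl).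
have cc := chart_map_at dy.
have cchc : {for y, continuous ((metric_mx g c \o chart_inv c) \o c)}.
  by apply: continuous_comp.
move=> B; rewrite -[in nbhs _ B](chart_invK dy) => nB.
have := cchc B nB => /= nB'.
have nd := nbhs_chart_dom dy.
suff : \forall z \near y, B (metric_mx g c z) by [].
have nB2 : \forall z \near y, B (metric_mx g c (chart_inv c (c z))) by exact: nB'.
by apply: filterS2 nB2 nd => z + dz; rewrite chart_invK.
Qed.

Lemma cvg_quadratic_form (T : Type) (F : set_system T) (FF : Filter F)
    (G : T -> 'M[R]_n) (v : T -> 'rV[R]_n) (G0 : 'M[R]_n) (v0 : 'rV[R]_n) :
  G s @[s --> F] --> G0 -> v s @[s --> F] --> v0 ->
  (v s *m G s *m (v s)^T) 0 0 @[s --> F] --> (v0 *m G0 *m v0^T) 0 0.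
Proof.
move=> cG cv.
have E (w : 'rV[R]_n) (H : 'M[R]_n) : (w *m H *m w^T) 0 0 =
    \sum_j (\sum_i w 0 i * H i j) * w 0 j.
  by rewrite mxE; apply: eq_bigr => j _; rewrite !mxE.
rewrite E; under eq_cvg do rewrite E.
have cvi i : (v s) 0 i @[s --> F] --> v0 0 i.
  exact: (cvg_comp _ _ cv (@coord_continuous R 1 n 0 i v0)).
have cGij i j : (G s) i j @[s --> F] --> G0 i j.
  exact: (cvg_comp _ _ cG (@coord_continuous R n n i j G0)).
have cadd : continuous (fun p : R * R => p.1 + p.2).
  by move=> p; apply: cvgD; [exact: cvg_fst|exact: cvg_snd].
apply: cvg_big => // j _; apply: cvgM; last exact: cvi.
by apply: cvg_big => // i _; apply: cvgM; [exact: cvi|exact: cGij].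
Qed.

Lemma cvg_metric_norm (T : Type) (F : set_system T) (FF : Filter F)
    (y : T -> M) (v : T -> 'rV[R]_n) c (y0 : M) (v0 : 'rV[R]_n) :
  atlas_charts A c -> chart_dom c y0 ->
  y s @[s --> F] --> y0 -> v s @[s --> F] --> v0 ->
  metric_norm c (y s) (v s) @[s --> F] --> metric_norm c y0 v0.
Proof.
move=> Ac dy cy cv.
have cG : metric_mx g c (y s) @[s --> F] --> metric_mx g c y0.
  exact: (cvg_comp _ _ cy (metric_mx_at Ac dy)).
have cq := cvg_quadratic_form FF cG cv.
exact: (cvg_comp _ _ cq (@sqrt_continuous R _)).
Qed.

End Charts.

(** * C^1 curves on closed intervals *)

Section C1Curves.
Variables (R : realType) (n : nat) (M : topologicalType).
Variables (A : smooth_atlas R n M) (g : riemannian_metric A).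
Implicit Types (c : chart R n M) (gam : R -> M).

Lemma within_itv_continuousP (T : topologicalType) (f : R -> T) (a b : R) :
  {within `[a, b], continuous f} <->
  forall t, a <= t <= b -> f u @[u --> within `[a, b] (nbhs t)] --> f t.
Proof.
split=> [cf t tab|h].
  have tab' : [set` `[a, b]] t by rewrite /= in_itv.
  by rewrite (nbhs_subspace_in tab'); exact: cf.
rewrite continuous_subspace_in => t; rewrite inE/= => tab.
have tab' : [set` `[a, b]] t by [].
have : a <= t <= b by move: tab; rewrite in_itv.
by move=> /h; rewrite (nbhs_subspace_in tab').
Qed.

Lemma within_nbhsE (T : topologicalType) (B : set T) (t : T) : nbhs t B ->
  within B (nbhs t) = nbhs t.
Proof.
move=> nB; apply/funext => C; apply/propext; split; last exact: cvg_within.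
move=> nC; have nC' : \forall u \near t, B u -> C u by exact: nC.
suff : \forall u \near t, C u by [].
by apply: filterS2 nB nC' => u Bu; exact.
Qed.

Lemma nbhs_itv (a b t : R) : a < t < b -> nbhs t [set` `]a, b[].
Proof.
move=> tab; apply: open_nbhs_nbhs; split; first exact: itv_open.
by rewrite /= in_itv.
Qed.

Lemma nbhs_segment (a b t : R) : a < t < b -> nbhs t [set` `[a, b]].
Proof.
move=> /nbhs_itv; apply: filterS => u; rewrite /= !in_itv/= => /andP[? ?].
by rewrite !ltW.
Qed.

Lemma has_derive_within_affine (V : normedModType R) (B C : set R) (f : R -> V)
    (e k t : R) l : `|e| <= 1 -> (forall u, B u -> C (e * u + k)) ->
  has_derive_within C f (e * t + k) l ->
  has_derive_within B (fun u => f (e * u + k)) t (e *: l).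
Proof.
move=> e1 BC h r r0; have [d d0 H] := h r r0; exists d => // u Bu ud.
have E : e * u + k - (e * t + k) = (u - t) * e by ring.
have le : `|(u - t) * e| <= `|u - t| by rewrite normrM ler_piMr.
have := H _ (BC u Bu); rewrite E scalerA => /(_ (le_lt_trans le ud)) H'.
by apply: le_trans H' _; rewrite ler_wpM2l// ltW.
Qed.

(** This replaces the limit inside [derive_within] by any family [D] of relative derivatives that is
    continuous at [t]. For a < b every point of the segment is an accumulation point of it, so
    relative derivatives are unique. *)
Lemma C1_curveP gam (a b : R) : a < b ->
  C1_curve A gam a b <->
  {within `[a, b], continuous gam} /\
  forall c t, atlas_charts A c -> a <= t <= b -> chart_dom c (gam t) ->
    exists D : R -> 'rV[R]_n,
    (\forall u \near within `[a, b] (nbhs t),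
       has_derive_within `[a, b] (c \o gam) u (D u)) /\
    D u @[u --> within `[a, b] (nbhs t)] --> D t.
Proof.
move=> ab; split=> [[cgam h]|[cgam h]]; split => // c t Ac tab dt.
  exists (derive_within `[a, b] (c \o gam)); split.
    have /within_itv_continuousP/(_ t tab) ct := cgam.
    have nd : \forall u \near within `[a, b] (nbhs t), chart_dom c (gam u).
      by apply: ct; exact: nbhs_chart_dom.
    have nab : \forall u \near within `[a, b] (nbhs t), [set` `[a, b]] u by exact: withinT.
    apply: filterS2 nd nab => u du uab.
    have [/= du' _] := h c u Ac uab du.
    by apply/diffquot_cvgP.
  by have [] := h c t Ac _ dt.
move: tab; rewrite in_itv/= => tab.
have [D [nD cD]] := h c t Ac tab dt.
have tin : [set` `[a, b]] t by rewrite /= in_itv.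
have Dt : has_derive_within `[a, b] (c \o gam) t (D t).
  by move: nD => /nbhs_singleton; apply.
have [d1 d2] := has_derive_within_derive ab tab Dt; split => //.
rewrite d2; apply: cvg_trans cD; apply: near_eq_cvg.
have nab : \forall u \near within `[a, b] (nbhs t), [set` `[a, b]] u by exact: withinT.
apply: filterS2 nD nab => u Du; rewrite /= in_itv/= => uab.
by have [_ ->] := has_derive_within_derive ab uab Du.
Qed.

Lemma eq_C1_curve gam gam' a b : a < b ->
  (forall t, a <= t <= b -> gam t = gam' t) -> C1_curve A gam a b ->
  C1_curve A gam' a b.
Proof.
move=> ab gg' /(C1_curveP _ ab)[cgam h]; apply/C1_curveP => //.
have E t : [set` `[a, b]] t -> gam t = gam' t by rewrite /= in_itv; exact: gg'.
split.
  move/within_itv_continuousP: cgam => cgam; apply/within_itv_continuousP => t tab.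
  rewrite -gg'//; apply: cvg_trans (cgam t tab); apply: near_eq_cvg.
  have nab : \forall u \near within `[a, b] (nbhs t), [set` `[a, b]] u by exact: withinT.
  by apply: filterS nab => u /E.
move=> c t Ac tab; rewrite -gg'// => dt; have [D [nD cD]] := h c t Ac tab dt.
exists D; split => //.
have nab : \forall u \near within `[a, b] (nbhs t), [set` `[a, b]] u by exact: withinT.
apply: filterS2 nD nab => u Du uab.
by apply: eq_has_derive_within Du => // w /E /= ->.
Qed.

Lemma cvg_within_affine (a b a' b' e k t : R) :
  (forall u, a' <= u <= b' -> a <= e * u + k <= b) ->
  e * u + k @[u --> within `[a', b'] (nbhs t)] --> within `[a, b] (nbhs (e * t + k)).
Proof.
move=> sig B nB.
have nB' : \forall v \near e * t + k, [set` `[a, b]] v -> B v by exact: nB.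
have ct : {for t, continuous (fun u : R => e * u + k)}.
  by apply: cvgD; [apply: cvgM; [exact: cvg_cst|exact: cvg_id]|exact: cvg_cst].
suff : \forall u \near t, [set` `[a', b']] u -> B (e * u + k) by [].
have nB2 : \forall u \near t, [set` `[a, b]] (e * u + k) -> B (e * u + k) by exact: (ct _ nB').
apply: filterS nB2 => u h uab.
by apply: h; rewrite /= in_itv/= sig//; move: uab; rewrite /= in_itv.
Qed.

Lemma C1_curve_affine gam (a b a' b' e k : R) : a < b -> a' < b' -> `|e| <= 1 ->
  (forall u, a' <= u <= b' -> a <= e * u + k <= b) ->
  C1_curve A gam a b -> C1_curve A (fun u => gam (e * u + k)) a' b'.
Proof.
move=> ab ab' e1 sig /(C1_curveP _ ab)[cgam h]; apply/C1_curveP => //; split.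
  move/within_itv_continuousP: cgam => cgam; apply/within_itv_continuousP => t tab.
  exact: (cvg_comp _ _ (cvg_within_affine sig) (cgam _ (sig t tab))).
move=> c t Ac tab dt; have [D [nD cD]] := h c _ Ac (sig t tab) dt.
exists (fun u => e *: D (e * u + k)); split.
  have nD' : \forall u \near within `[a', b'] (nbhs t),
      has_derive_within `[a, b] (c \o gam) (e * u + k) (D (e * u + k)).
    exact: (@cvg_within_affine a b a' b' e k t sig _ nD).
  apply: filterS nD' => u Du.
  apply: (has_derive_within_affine e1 _ Du) => w; rewrite /= !in_itv/=; exact: sig.
have := cvg_comp _ _ (@cvg_within_affine a b a' b' e k t sig) cD.
exact: cvgZl_tmp.
Qed.

Lemma C1_curve_sub gam (a b a' b' : R) : a <= a' -> a' < b' -> b' <= b ->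
  C1_curve A gam a b -> C1_curve A gam a' b'.
Proof.
move=> aa' ab' bb' h; have ab : a < b by lra.
have e1 : `|1 : R| <= 1 by rewrite normr1.
have := @C1_curve_affine gam a b a' b' 1 0 ab ab' e1 _ h.
move=> /(_ _)/(eq_C1_curve ab'); apply.
  by move=> t _; rewrite mul1r addr0.
by move=> u /andP[au ub]; rewrite mul1r addr0; apply/andP; lra.
Qed.

(** At an end point [speed] takes a two-sided derivative and may have an unrelated value. Hence the
    limit along the open interval, which is the norm of the one-sided velocity. *)
Lemma C1_curve_speed gam a b t c : a < b -> C1_curve A gam a b -> a <= t <= b ->
  atlas_charts A c -> chart_dom c (gam t) -> exists v,
  has_derive_within `[a, b] (c \o gam) t v /\
  speed g gam u @[u --> within `]a, b[ (nbhs t)] --> metric_norm g c (gam t) v.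
Proof.
move=> ab /(C1_curveP _ ab)[cgam h] tab Ac dt.
have [D [nD cD]] := h c t Ac tab dt; exists (D t).
have tin : [set` `[a, b]] t by rewrite /= in_itv.
split; first by move: nD => /nbhs_singleton; apply.
have fine_ : within `]a, b[ (nbhs t) `=>` within `[a, b] (nbhs t).
  move=> B nB; have nB' : \forall u \near t, [set` `[a, b]] u -> B u by exact: nB.
  suff : \forall u \near t, [set` `]a, b[] u -> B u by [].
  apply: filterS nB' => u h' uab; apply: h'.
  by move: uab; rewrite /= !in_itv/= => /andP[au ub]; rewrite !ltW.
move/within_itv_continuousP: cgam => cgam; have ct := cgam t tab.
have nd : \forall u \near within `]a, b[ (nbhs t), chart_dom c (gam u).
  by apply: fine_; apply: ct; exact: nbhs_chart_dom.
have nab : \forall u \near within `]a, b[ (nbhs t), [set` `]a, b[] u by exact: withinT.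
have nD' : \forall u \near within `]a, b[ (nbhs t),
    has_derive_within `[a, b] (c \o gam) u (D u) by exact: fine_ nD.
have cm : metric_norm g c (gam u) (D u) @[u --> within `]a, b[ (nbhs t)] -->
    metric_norm g c (gam t) (D t).
  apply: cvg_metric_norm => //.
    by apply: cvg_trans ct; exact: cvg_app.
  by apply: cvg_trans cD; exact: cvg_app.
apply: cvg_trans cm; apply: near_eq_cvg.
near=> u; apply/esym; apply: speed_chart => //.
- by near: u.
- have uab : a < u < b by have : [set` `]a, b[] u by near: u.
  have uab' : a <= u <= b by case/andP: uab => ? ?; rewrite !ltW.
  by have := cgam u uab'; rewrite within_nbhsE//; exact: nbhs_segment.
- have uab : a < u < b by have : [set` `]a, b[] u by near: u.
  have Du : has_derive_within `[a, b] (c \o gam) u (D u) by near: u.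
  exact: has_derive_within_interior uab Du.
Unshelve. all: by end_near. Qed.

Lemma speed_ge0 gam t : 0 <= speed g gam t.
Proof. exact: sqrtr_ge0. Qed.

Lemma measurable_speed_C1 gam a b : a < b -> C1_curve A gam a b ->
  measurable_fun `[a, b] (speed g gam).
Proof.
move=> ab Cgam; apply: (@measurable_fun_itv_cc _ _ _ false true).
apply: subspace_continuous_measurable_fun; first exact: measurable_itv.
rewrite continuous_subspace_in => t; rewrite inE/= => tab.
have tab' : a <= t <= b by move: tab; rewrite in_itv/= => /andP[? ?]; rewrite !ltW.
have [v [hv cs]] := C1_curve_speed ab Cgam tab' (chart_at_atlas A (gam t))
  (chart_at_dom A (gam t)).
have tin : [set` `]a, b[] t by [].
suff : speed g gam u @[u --> within `]a, b[ (nbhs t)] --> speed g gam t.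
  by rewrite (nbhs_subspace_in tin).
suff -> : speed g gam t = metric_norm g (chart_at A (gam t)) (gam t) v by [].
apply: speed_chart; [exact: chart_at_atlas|exact: chart_at_dom| |].
  have [cgam _] := Cgam; move/within_itv_continuousP: cgam => /(_ t tab').
  by rewrite within_nbhsE//; apply: nbhs_segment; move: tab; rewrite in_itv.
by move: tab; rewrite in_itv/= => tab; exact: has_derive_within_interior tab hv.
Qed.

End C1Curves.

(** * Length of piecewise C1 curves *)

Section SegmentIntegral.
Variable R : realType.
Implicit Types (f : R -> R) (a b t k : R).
Local Notation mu := (@lebesgue_measure R).

Lemma segment_integral_split f a t b : measurable_fun `[a, b] f -> (forall u, 0 <= f u) ->
  a <= t <= b ->
  (\int[mu]_(u in `[a, b]) (f u)%:E =
   \int[mu]_(u in `[a, t]) (f u)%:E + \int[mu]_(u in `[t, b]) (f u)%:E)%E.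
Proof.
move=> mf f0 /andP[at_ tb].
have E : `[a, b]%classic = `[a, t]%classic `|` `]t, b]%classic.
  by rewrite -itv_bndbnd_setU// bnd_simp.
have mf1 : measurable_fun `]t, b] (EFin \o f).
  apply/measurable_EFinP; apply: measurable_funS mf => //.
  by rewrite E; exact: subsetUr.
rewrite -[X in (_ = _ + X)%E]integral_itv_obnd_cbnd// E ge0_integral_setU//.
- by rewrite -E; exact/measurable_EFinP.
- by move=> u _; rewrite lee_fin.
- apply/disj_setPS => u [] /=; rewrite !in_itv/= => /andP[_ ut] /andP[tu _].
  by move: ut; rewrite leNgt tu.
Qed.

Lemma segment_integral_cst a b k : a <= b ->
  (\int[mu]_(u in `[a, b]) k%:E = (k * (b - a))%:E)%E.
Proof.
move=> ab; transitivity (k%:E * mu `[a, b]%classic)%E; first exact: integral_cst.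
rewrite lebesgue_measure_itv/= lte_fin; case: ifP => [_|/negbT].
  by rewrite EFinM EFinB.
rewrite -leNgt => ba; have -> : b = a by apply/eqP; rewrite eq_le ab ba.
by rewrite subrr mulr0 mule0.
Qed.

Lemma segment_integral_ge f a b k : measurable_fun `[a, b] f -> (forall u, 0 <= f u) ->
  a <= b -> (forall u, a < u < b -> k <= f u) ->
  ((k * (b - a))%:E <= \int[mu]_(u in `[a, b]) (f u)%:E)%E.
Proof.
move=> mf f0 ab kf; have ge0 : (0 <= \int[mu]_(u in `[a, b]) (f u)%:E)%E.
  by apply: integral_ge0 => u _; rewrite lee_fin.
have [k0|k0] := leP k 0.
  by apply: le_trans ge0; rewrite lee_fin mulr_le0_ge0// subr_ge0.
rewrite -segment_integral_cst//.
have mfo : measurable_fun `]a, b[ f.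
  by apply: measurable_funS mf => //; exact: subset_itv_oo_cc.
rewrite (@integral_itv_bndoo _ _ _ (fun=> k%:E)); last exact: measurable_cst.
rewrite (@integral_itv_bndoo _ _ _ (EFin \o f)); last exact/measurable_EFinP.
apply: ge0_le_integral.
- exact: measurable_itv.
- by move=> u _; rewrite lee_fin ltW.
- exact: measurable_cst.
- exact/measurable_EFinP.
- by move=> u; rewrite /= in_itv/= => uab; rewrite lee_fin kf.
Qed.

Lemma segment_integral_le f a b k : measurable_fun `[a, b] f -> (forall u, 0 <= f u) ->
  a <= b -> (forall u, a < u < b -> f u <= k) ->
  (\int[mu]_(u in `[a, b]) (f u)%:E <= (k * (b - a))%:E)%E.
Proof.
move=> mf f0 ab fk; rewrite -segment_integral_cst//.
have mfo : measurable_fun `]a, b[ f.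
  by apply: measurable_funS mf => //; exact: subset_itv_oo_cc.
rewrite (@integral_itv_bndoo _ _ _ (fun=> k%:E)); last exact: measurable_cst.
rewrite (@integral_itv_bndoo _ _ _ (EFin \o f)); last exact/measurable_EFinP.
apply: ge0_le_integral.
- exact: measurable_itv.
- by move=> u _; rewrite lee_fin.
- exact/measurable_EFinP.
- exact: measurable_cst.
- by move=> u; rewrite /= in_itv/= => uab; rewrite lee_fin fk.
Qed.

Lemma lebesgue_measure_shift k (B : set R) : measurable B ->
  pushforward mu ((fun u => u + k) : measurableTypeR R -> measurableTypeR R) B = mu B.
Proof.
have mshift : measurable_fun setT ((fun u => u + k) : measurableTypeR R -> measurableTypeR R).
  by apply: measurable_funD; [exact: measurable_id|exact: measurable_cst].
pose shiftm : {mfun measurableTypeR R >-> measurableTypeR R} :=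
  HB.pack ((fun u => u + k) : measurableTypeR R -> measurableTypeR R)
    (isMeasurableFun.Build _ _ _ _ _ mshift).
move=> mB; apply/esym.
apply: (@lebesgue_measure_unique R (pushforward mu shiftm)) => //= _ [[a b]] _ <-.
have E : (fun u => u + k) @^-1` `]a, b]%classic = `]a - k, b - k]%classic.
  by apply/seteqP; split => u /=; rewrite !in_itv/= ltrBlDr lerBrDr.
rewrite /pushforward [X in _ = mu X]E !lebesgue_measure_itv/=.
rewrite !lte_fin ltrD2r; case: ifP => // _; rewrite -!EFinB; congr EFin.
by ring.
Qed.

Lemma segment_integral_shift f a b k : measurable_fun `[a, b] f -> (forall u, 0 <= f u) ->
  (\int[mu]_(u in `[(a - k)%R, (b - k)%R]) (f (u + k)%R)%:E =
   \int[mu]_(u in `[a, b]) (f u)%:E)%E.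
Proof.
move=> mf f0.
have mshift : measurable_fun setT ((fun u => u + k) : measurableTypeR R -> measurableTypeR R).
  by apply: measurable_funD; [exact: measurable_id|exact: measurable_cst].
have E : `[a - k, b - k]%classic =
    ((fun u => u + k) : measurableTypeR R -> measurableTypeR R) @^-1` `[a, b]%classic.
  by apply/seteqP; split => u /=; rewrite !in_itv/= lerBlDr lerBrDr.
rewrite E -(@ge0_integral_pushforward _ _ _ _ _ _ mshift mu `[a, b]%classic (EFin \o f))//.
- by apply: eq_measure_integral => B mB _; exact: lebesgue_measure_shift.
- exact/measurable_EFinP.
- by move=> u _; rewrite lee_fin.
Qed.

Lemma segment_integral_opp f a b : measurable_fun `[a, b] f -> (forall u, 0 <= f u) ->
  (\int[mu]_(u in `[(- b)%R, (- a)%R]) (f (- u)%R)%:E =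
   \int[mu]_(u in `[a, b]) (f u)%:E)%E.
Proof.
move=> mf f0.
have mopp : measurable_fun setT (-%R : measurableTypeR R -> measurableTypeR R).
  by apply: continuous_measurable_fun; exact: opp_continuous.
have E : `[- b, - a]%classic =
    (-%R : measurableTypeR R -> measurableTypeR R) @^-1` `[a, b]%classic.
  by apply/seteqP; split => u /=; rewrite !in_itv/= lerNl lerNr andbC.
rewrite E -(@ge0_integral_pushforward _ _ _ _ _ _ mopp mu `[a, b]%classic (EFin \o f))//.
- by apply: eq_measure_integral => B mB _; exact: lebesgue_measureN.
- exact/measurable_EFinP.
- by move=> u _; rewrite lee_fin.
Qed.

End SegmentIntegral.

(** * Cutting, moving and joining curves; the infimum of their lengths *)

Section PiecewiseC1.
Variables (R : realType) (n : nat) (M : topologicalType).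
Variables (A : smooth_atlas R n M) (g : riemannian_metric A).
Implicit Types (gam : R -> M) (a b t : R).

(** The form of [piecewise_C1_curve] suited to induction; the degenerate case is the empty
    partition. *)
Inductive pwC1 gam : R -> R -> Prop :=
| PwC1Nil a : pwC1 gam a a
| PwC1Cons a t b : a < t -> C1_curve A gam a t -> pwC1 gam t b -> pwC1 gam a b.

Lemma piecewise_C1P gam a b : piecewise_C1_curve A gam a b <-> pwC1 gam a b.
Proof.
split=> [[s]|].
  elim: s a => [|t s IH] a; first by move=> /itv_partition_nil <- _; exact: PwC1Nil.
  move=> pts h; have := pts; rewrite /itv_partition /= => -[/andP[at_ _] _].
  apply: (PwC1Cons at_ (h 0%N isT)); apply: IH; first exact: itv_partition_cons pts.
  move=> i si; have := h i.+1 si => /=.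
  have -> : nth a (t :: s) i = nth t (t :: s) i.
    by apply: set_nth_default; rewrite /= ltnS ltnW.
  by have -> : nth a s i = nth t s i by exact: set_nth_default.
elim=> {a b} [a|a t b at_ Cat _ [s [ps ls] h]].
  by exists [::] => //; split => //=.
exists (t :: s); first by split => //=; rewrite at_.
case=> [_|i] //= si.
have -> : nth a (t :: s) i = nth t (t :: s) i.
  by apply: set_nth_default; rewrite /= ltnS ltnW.
have -> : nth a s i = nth t s i by exact: set_nth_default.
exact: h.
Qed.

Lemma pwC1_le gam a b : pwC1 gam a b -> a <= b.
Proof. by elim=> // {}a t {}b at_ _ _ tb; exact: le_trans (ltW at_) tb. Qed.

Lemma pwC1_cat gam a t b : pwC1 gam a t -> pwC1 gam t b -> pwC1 gam a b.
Proof.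
by move=> h; elim: h b => // {}a s {}t as_ C _ IH b /IH; exact: PwC1Cons.
Qed.

Lemma pwC1_single gam a b : a < b -> C1_curve A gam a b -> pwC1 gam a b.
Proof. by move=> ab C; apply: PwC1Cons ab C _; exact: PwC1Nil. Qed.

Lemma pwC1_split gam a b t : pwC1 gam a b -> a <= t <= b ->
  pwC1 gam a t /\ pwC1 gam t b.
Proof.
elim=> {a b} [a|a s b as_ C h IH] /andP[at_ tb].
  by have -> : t = a; [apply/eqP; rewrite eq_le at_ tb|split; exact: PwC1Nil].
have [st|ts] := leP s t.
  have [|h1 h2] := IH; first by rewrite st.
  by split => //; exact: PwC1Cons h1.
move: at_; rewrite le_eqVlt => /predU1P[<-|lat].
  by split; [exact: PwC1Nil|exact: PwC1Cons h].
split; first by apply: pwC1_single => //; apply: C1_curve_sub C => //; exact: ltW.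
by apply: PwC1Cons h => //; apply: C1_curve_sub C => //; exact: ltW.
Qed.

Lemma eq_pwC1 gam gam' a b : (forall t, a <= t <= b -> gam t = gam' t) ->
  pwC1 gam a b -> pwC1 gam' a b.
Proof.
move=> E h; elim: h E => {a b} [a _|a t b at_ C h IH E]; first exact: PwC1Nil.
have tb := pwC1_le h.
apply: (PwC1Cons at_).
  apply: eq_C1_curve C => // u /andP[au ut]; apply: E.
  by rewrite au (le_trans ut).
by apply: IH => u /andP[tu ub]; apply: E; rewrite ub andbT (le_trans (ltW at_)).
Qed.

Lemma pwC1_shift gam a b k : pwC1 gam a b -> pwC1 (fun u => gam (u + k)) (a - k) (b - k).
Proof.
elim=> {a b} [a|a t b at_ C _ IH]; first exact: PwC1Nil.
have at' : a - k < t - k by rewrite ltrD2r.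
apply: (PwC1Cons at') => //.
have e1 : `|1 : R| <= 1 by rewrite normr1.
apply: eq_C1_curve (@C1_curve_affine _ _ _ _ gam a t _ _ 1 k at_ at' e1 _ C) => //.
  by move=> u _; rewrite mul1r.
by move=> u; rewrite mul1r lerBlDr lerBrDr.
Qed.

Lemma pwC1_opp gam a b : pwC1 gam a b -> pwC1 (fun u => gam (- u)) (- b) (- a).
Proof.
elim=> {a b} [a|a t b at_ C _ IH]; first exact: PwC1Nil.
have at' : - t < - a by rewrite ltrN2.
apply: pwC1_cat IH _; apply: pwC1_single => //.
have e1 : `|-1 : R| <= 1 by rewrite normrN1.
apply: eq_C1_curve (@C1_curve_affine _ _ _ _ gam a t _ _ (-1) 0 at_ at' e1 _ C) => //.
  by move=> u _; rewrite mulN1r addr0.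
by move=> u; rewrite mulN1r addr0 lerNr lerNl andbC.
Qed.

Lemma itv_setU_segment a t b : a <= t <= b ->
  `[a, b]%classic = `[a, t]%classic `|` `[t, b]%classic.
Proof.
move=> /andP[at_ tb]; apply/seteqP; split => u /=; rewrite !in_itv/=.
  by move=> /andP[au ub]; have [ut|tu] := leP u t; [left|right]; rewrite ?au ?ub ?(ltW tu).
move=> [/andP[au ut]|/andP[tu ub]]; first by rewrite au (le_trans ut).
by rewrite ub andbT (le_trans at_).
Qed.

Lemma pwC1_continuous gam a b : pwC1 gam a b -> {within `[a, b], continuous gam}.
Proof.
elim=> {a b} [a|a t b at_ [C _] h IH].
  by rewrite set_itv1; exact: continuous_subspace1.
rewrite (@itv_setU_segment a t b); last by rewrite (ltW at_) (pwC1_le h).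
by apply: withinU_continuous => //; exact: itv_closed.
Qed.

Lemma pwC1_measurable_speed gam a b : pwC1 gam a b ->
  measurable_fun `[a, b] (speed g gam).
Proof.
elim=> {a b} [a|a t b at_ C h IH].
  by rewrite set_itv1; exact: measurable_fun_set1.
rewrite (@itv_setU_segment a t b); last by rewrite (ltW at_) (pwC1_le h).
apply/measurable_funU; [exact: measurable_itv|exact: measurable_itv|split => //].
exact: measurable_speed_C1.
Qed.

Lemma curve_length_ge0 gam a b : (0 <= curve_length g gam a b)%E.
Proof. by apply: integral_ge0 => u _; rewrite lee_fin speed_ge0. Qed.

Lemma curve_length_split gam a t b : pwC1 gam a b -> a <= t <= b ->
  (curve_length g gam a b = curve_length g gam a t + curve_length g gam t b)%E.
Proof.
move=> h tab; apply: segment_integral_split => //; first exact: pwC1_measurable_speed.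
by move=> u; exact: speed_ge0.
Qed.

Lemma curve_length_nil gam a : curve_length g gam a a = 0%E.
Proof. by rewrite /curve_length set_itv1 integral_set1. Qed.

Lemma near_eq_speed gam gam' t : (\forall u \near t, gam u = gam' u) ->
  speed g gam t = speed g gam' t.
Proof.
move=> E; have Et : gam t = gam' t by exact: nbhs_singleton E.
rewrite /speed -Et; set c := chart_at A (gam t).
suff -> : derive1 (c \o gam) t = derive1 (c \o gam') t by [].
have E' : \forall u \near t, (c \o gam) u = (c \o gam') u.
  by apply: filterS E => u /= ->.
by rewrite !derive1E; apply: near_eq_derive => //; exact: oner_neq0.
Qed.

(** The speeds agree only in the open interval, since the derivative at an end point also sees the
    values outside; the two end points are negligible. *)
Lemma eq_curve_length gam gam' a b : (forall t, a <= t <= b -> gam t = gam' t) ->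
  pwC1 gam a b -> curve_length g gam a b = curve_length g gam' a b.
Proof.
move=> E h; apply: eq_integral_itv_bounded.
- apply: measurable_funS (pwC1_measurable_speed h) => //.
  exact: subset_itv_oo_cc.
- apply: measurable_funS (pwC1_measurable_speed (eq_pwC1 E h)) => //.
  exact: subset_itv_oo_cc.
- move=> t; rewrite in_itv/= => tab; apply: near_eq_speed.
  by apply: filterS (nbhs_itv tab) => u; rewrite /= in_itv/= => /andP[? ?]; rewrite E// !ltW.
Qed.

Lemma speed_shift gam k t : speed g (fun u => gam (u + k)) t = speed g gam (t + k).
Proof.
rewrite /speed; set c := chart_at A _.
suff -> : derive1 (c \o (fun u => gam (u + k))) t = derive1 (c \o gam) (t + k) by [].
by rewrite /derive1 /=; do 2 f_equal; apply/funext => h; rewrite addrA.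
Qed.

Lemma curve_length_shift gam a b k : pwC1 gam a b ->
  curve_length g (fun u => gam (u + k)) (a - k) (b - k) = curve_length g gam a b.
Proof.
move=> h; rewrite /curve_length.
rewrite -[RHS](segment_integral_shift k); last 2 first.
- exact: pwC1_measurable_speed.
- by move=> u; exact: speed_ge0.
by apply: eq_integral => u _; rewrite speed_shift.
Qed.

Lemma C1_curve_velocity gam a b t : a < t < b -> C1_curve A gam a b ->
  {for t, continuous gam} /\
  exists v, has_derive_within setT (chart_at A (gam t) \o gam) t v.
Proof.
move=> tab C; have ab : a < b by case/andP: tab; exact: lt_trans.
have tab' : a <= t <= b by case/andP: tab => ? ?; rewrite !ltW.
split.
  have [/within_itv_continuousP/(_ t tab') cg _] := C.
  by move: cg; rewrite within_nbhsE//; exact: nbhs_segment.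
have [v [hv _]] := C1_curve_speed g ab C tab' (chart_at_atlas A (gam t))
  (chart_at_dom A (gam t)).
by exists v; exact: has_derive_within_interior hv.
Qed.

Lemma metric_normN c y v : metric_norm g c y (- v) = metric_norm g c y v.
Proof. by rewrite /metric_norm linearN /= mulNmx mulNmx mulmxN opprK. Qed.

Lemma speed_opp gam a b t : a < - t < b -> C1_curve A gam a b ->
  speed g (fun u => gam (- u)) t = speed g gam (- t).
Proof.
move=> tab C; have [cg [v hv]] := C1_curve_velocity tab C.
set c := chart_at A (gam (- t)) in hv.
have Ac : atlas_charts A c := chart_at_atlas A (gam (- t)).
have dc : chart_dom c (gam (- t)) := chart_at_dom A (gam (- t)).
rewrite (speed_chart g Ac dc cg hv) -metric_normN.
apply: speed_chart => //.
  by apply: continuous_comp; [exact: opp_continuous|exact: cg].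
have e1 : `|-1 : R| <= 1 by rewrite normrN1.
have := @has_derive_within_affine R _ setT setT (c \o gam) (-1) 0 t v e1.
rewrite mulN1r addr0 scaleN1r => /(_ (fun _ => id) hv).
by apply: eq_has_derive_within => // u _; rewrite mulN1r addr0.
Qed.

(** The induction goes over the pieces because [speed_opp] needs the derivative to exist, which
    holds in the interior of a C^1 piece. *)
Lemma curve_length_opp gam a b : pwC1 gam a b ->
  curve_length g (fun u => gam (- u)) (- b) (- a) = curve_length g gam a b.
Proof.
elim=> {a b} [a|a t b at_ C h IH]; first by rewrite !curve_length_nil.
have tb := pwC1_le h; have tab : a <= t <= b by rewrite ltW.
have hab : pwC1 gam a b by exact: PwC1Cons h.
rewrite (curve_length_split hab tab).
have tab' : - b <= - t <= - a by rewrite !lerN2 tb ltW.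
have hat : pwC1 gam a t by exact: pwC1_single.
have := pwC1_opp hab; have := pwC1_opp hat.
set gop := fun u => gam (- u); move=> hat' hab'.
have -> : curve_length g gop (- b) (- a) =
    (curve_length g gop (- b) (- t) + curve_length g gop (- t) (- a))%E.
  exact: curve_length_split.
rewrite IH addeC.
suff -> : curve_length g gop (- t) (- a) = curve_length g gam a t by [].
rewrite /curve_length -[RHS]segment_integral_opp; last 2 first.
- exact: pwC1_measurable_speed.
- by move=> u; exact: speed_ge0.
have moo : measurable_fun `]- t, - a[ (speed g gop).
  apply: measurable_funS (pwC1_measurable_speed hat'); first exact: measurable_itv.
  exact: subset_itv_oo_cc.
have E : {in `]- t, - a[, speed g gop =1 (fun u => speed g gam (- u))}.
  move=> u; rewrite in_itv/= => /andP[tu ua]; apply: (speed_opp _ C).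
  by rewrite ltrNr ua ltrNl.
have moo2 : measurable_fun `]- t, - a[ (fun u => speed g gam (- u)).
  by apply: eq_measurable_fun moo => u; rewrite inE/= => /E.
exact: (@eq_integral_itv_bounded R (- t) (- a) (fun u => speed g gam (- u))
  (speed g gop) true false moo moo2 E).
Qed.

(** The infimum before [fine], to be used as long as it is not known to be finite. *)
Definition edist (x y : M) : \bar R :=
  ereal_inf [set L | exists (a b : R) (gam : R -> M),
    [/\ a < b, piecewise_C1_curve A gam a b, gam a = x, gam b = y
      & L = curve_length g gam a b]].

Lemma geodesic_distE x y : geodesic_dist g x y = fine (edist x y).
Proof. by []. Qed.

Lemma edist_ge0 x y : (0 <= edist x y)%E.
Proof.
by apply: le_ereal_inf_tmp => _ [a [b [gam [_ _ _ _ ->]]]]; exact: curve_length_ge0.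
Qed.

Lemma edist_le_length gam a b : a < b -> pwC1 gam a b ->
  (edist (gam a) (gam b) <= curve_length g gam a b)%E.
Proof.
move=> ab h; apply: ereal_inf_lbound; exists a, b, gam; split => //.
exact/piecewise_C1P.
Qed.

Lemma edist_ltP x y (r : \bar R) : (edist x y < r)%E -> exists a b gam,
  [/\ a < b, pwC1 gam a b, gam a = x, gam b = y & (curve_length g gam a b < r)%E].
Proof.
move=> xyr; apply: contrapT => h; move: xyr; apply/negP; rewrite -leNgt.
apply: le_ereal_inf_tmp => _ [a [b [gam [ab /piecewise_C1P pw ga gb ->]]]].
by rewrite leNgt; apply/negP => lr; apply: h; exists a, b, gam.
Qed.

Lemma edist_sym_le x y : (edist y x <= edist x y)%E.
Proof.
apply: le_ereal_inf_tmp => _ [a [b [gam [ab /piecewise_C1P pw ga gb ->]]]].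
have ba : - b < - a by rewrite ltrN2.
have := edist_le_length ba (pwC1_opp pw).
by rewrite !opprK ga gb curve_length_opp.
Qed.

Lemma edist_sym x y : edist x y = edist y x.
Proof. by apply/eqP; rewrite eq_le !edist_sym_le. Qed.

(** With strict bounds by reals, the triangle inequality follows by joining two actual curves, the
    second one shifted by [k] so as to start at [b], and no sum of infinite values occurs. *)
Lemma edist_lt_add x y z (r s : R) : (edist x y < r%:E)%E -> (edist y z < s%:E)%E ->
  (edist x z < (r + s)%:E)%E.
Proof.
move=> /edist_ltP[a [b [gam [ab pw ga gb lr]]]].
move=> /edist_ltP[a' [b' [gam' [ab' pw' ga' gb' ls]]]].
have [k ha'] : exists k, a' - k = b by exists (a' - b); ring.
have pwk := pwC1_shift k pw'; rewrite ha' in pwk.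
have lk := curve_length_shift k pw'; rewrite ha' in lk.
have [c cE] : exists c, c = b' - k by exists (b' - k).
have bc : b < c by rewrite cE; lra.
rewrite -cE in pwk lk.
pose G u := if u <= b then gam u else gam' (u + k).
have G1 t : a <= t <= b -> gam t = G t by move=> /andP[_ tb]; rewrite /G tb.
have G2 t : b <= t <= c -> gam' (t + k) = G t.
  move=> /andP[bt _]; have [tb|tb] := boolP (t <= b); last by rewrite /G (negbTE tb).
  rewrite /G tb; have -> : t = b by apply/eqP; rewrite eq_le tb bt.
  have -> : b + k = a' by rewrite -ha' subrK.
  by rewrite ga' gb.
have pwG1 := eq_pwC1 G1 pw; have pwG2 := eq_pwC1 G2 pwk.
have pwG := pwC1_cat pwG1 pwG2.
have := edist_le_length (lt_trans ab bc) pwG.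
have Ga : G a = x by rewrite -G1 ?lexx ?(ltW ab).
have Gc : G c = z.
  have cc : b <= c <= c by rewrite lexx ltW.
  by rewrite -(G2 c cc) cE subrK.
rewrite Ga Gc => /le_lt_trans; apply.
have abc : a <= b <= c by rewrite (ltW ab) (ltW bc).
rewrite (curve_length_split pwG abc) EFinD.
have L1 : curve_length g G a b = curve_length g gam a b.
  by apply/esym; exact: eq_curve_length.
have L2 : curve_length g G b c = curve_length g gam' a' b'.
  by rewrite -lk; apply/esym; exact: eq_curve_length.
by rewrite L1 L2; exact: lteD.
Qed.

End PiecewiseC1.

(** * Comparison with coordinates *)

Section LocalComparison.
Variables (R : realType) (n : nat) (M : topologicalType).
Variables (A : smooth_atlas R n M) (g : riemannian_metric A).
Hypothesis M_hausdorff : hausdorff_space M.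
Implicit Types (c : chart R n M) (gam : R -> M) (x y z : M).
Local Notation edist := (edist g).

Lemma metric_normZ c y a v : metric_norm g c y (a *: v) = `|a| * metric_norm g c y v.
Proof.
rewrite /metric_norm linearZ /= -scalemxAl -scalemxAl -scalemxAr scalerA mxE.
by rewrite -expr2 sqrtrM ?sqr_ge0// sqrtr_sqr.
Qed.

Lemma metric_norm_gt0 c y v : atlas_charts A c -> chart_dom c y -> v != 0 ->
  0 < metric_norm g c y v.
Proof. by move=> Ac dy v0; rewrite sqrtr_gt0; exact: metric_mx_posdef. Qed.

Lemma unit_sphere_compact : compact [set v : 'rV[R]_n | `|v| = 1].
Proof.
apply: bounded_closed_compact.
  by exists 1; split => // b b1 v /= ->; exact: ltW.
have -> : [set v : 'rV[R]_n | `|v| = 1] = (fun v => `|v|) @^-1` [set 1] by [].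
apply: closed_comp; first by move=> v _; exact: norm_continuous.
exact: closed_eq.
Qed.

(** By homogeneity it suffices to treat unit vectors; the unit sphere is compact, and the metric
    norm is jointly continuous and positive there. *)
Lemma metric_norm_comparison c x : atlas_charts A c -> chart_dom c x ->
  exists2 m, 0 < m & \forall y \near x, forall v,
    m * `|v| <= metric_norm g c y v /\ m * metric_norm g c y v <= `|v|.
Proof.
move=> Ac dx.
have /compact_near_coveringP cover := unit_sphere_compact.
(* The parameter [i] pairs a point near [x] with a candidate constant near 0 from the right, so that
   compactness yields one neighbourhood and one constant for all directions. *)
pose P (i : M * R) (v : 'rV[R]_n) :=
  i.2 < metric_norm g c i.1 v /\ i.2 * metric_norm g c i.1 v < 1.
pose F := filter_prod (nbhs x) (0 : R)^'+.
have local v : `|v| = 1 -> \forall v' \near v & i \near F, P i v'.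
  move=> v1; have v0 : v != 0.
    by apply: contra_eq_neq v1 => ->; rewrite normr0 eq_sym oner_neq0.
  have m0 := metric_norm_gt0 Ac dx v0; set m := metric_norm g c x v in m0.
  pose G := filter_prod (nbhs v) F.
  have cm : metric_norm g c p.2.1 p.1 @[p --> G] --> m.
    apply: cvg_metric_norm => //; last exact: cvg_fst.
    by apply: cvg_comp; [exact: cvg_snd|exact: cvg_fst].
  have lo : \forall p \near G, m / 2 < metric_norm g c p.2.1 p.1.
    by apply: (cvgr_gt _ cm); lra.
  have hi : \forall p \near G, metric_norm g c p.2.1 p.1 < m + 1.
    by apply: (cvgr_lt _ cm); lra.
  have ck : p.2.2 @[p --> G] --> (0 : R)^'+.
    by apply: cvg_comp; [exact: cvg_snd|exact: cvg_snd].
  have k0 : \forall p \near G, 0 < p.2.2 by exact: (ck _ (nbhs_right_gt (0 : R))).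
  have k1 : \forall p \near G, p.2.2 < m / 2.
    have m20 : 0 < m / 2 by lra.
    exact: (ck _ (nbhs_right_lt m20)).
  have k2 : \forall p \near G, p.2.2 < (m + 1)^-1.
    have m1V : 0 < (m + 1)^-1 by rewrite invr_gt0; lra.
    exact: (ck _ (nbhs_right_lt m1V)).
  suff : \forall p \near G, P p.2 p.1 by [].
  have FG : Filter G by exact: _.
  have lohi := @filterI _ G FG _ _ lo hi.
  have k012 := @filterI _ G FG _ _ k0 (@filterI _ G FG _ _ k1 k2).
  apply: (@filterS2 _ G FG _ _ _ _ lohi k012) => p [pl ph] [p0 [pm p1]].
  split; first exact: lt_trans pm pl.
  have m10 : 0 < m + 1 by lra.
  apply: (@lt_trans _ _ (p.2.2 * (m + 1))); first by rewrite ltr_pM2l.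
  by rewrite -ltr_pdivlMr// div1r.
have [[U V] [/= nU nV] UV] := cover _ F P _ local.
have [k [k0 Vk]] : exists k : R, 0 < k /\ V k.
  have : \forall k \near (0 : R)^'+, 0 < k /\ V k.
    by apply: filterI => //; exact: nbhs_right_gt.
  by move=> /filter_ex.
exists k => //; apply: filterS nU => y Uy v.
have [->|v0] := eqVneq v 0.
  have -> : metric_norm g c y 0 = 0.
    by have := metric_normZ c y 0 0; rewrite scale0r normr0 mul0r.
  by rewrite normr0 mulr0.
have nv : 0 < `|v| by rewrite normr_gt0.
pose w := `|v|^-1 *: v.
have w1 : `|w| = 1 by rewrite normrZ normfV normr_id mulVf// gt_eqF.
have vE : v = `|v| *: w by rewrite scalerA mulfV ?scale1r// gt_eqF.
have [/= kw kw1] : P (y, k) w by exact: (UV (y, k)).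
have mE : metric_norm g c y v = `|v| * metric_norm g c y w.
  by rewrite [in LHS]vE metric_normZ normr_id.
rewrite mE; split; first by rewrite mulrC ler_pM2l// ltW.
by rewrite mulrCA ler_piMr// ltW.
Qed.

Definition coordinate_ball x (rho m : R) : Prop :=
  let c := chart_at A x in [/\ 0 < rho, 0 < m,
    forall w, `|w - c x| < rho -> (c @` chart_dom c) w
    & forall y v, chart_dom c y -> `|c y - c x| < rho ->
      m * `|v| <= metric_norm g c y v /\ m * metric_norm g c y v <= `|v|].

Lemma exists_coordinate_ball x : exists rho m, coordinate_ball x rho m.
Proof.
set c := chart_at A x; have Ac : atlas_charts A c := chart_at_atlas A x.
have dx : chart_dom c x := chart_at_dom A x.
have [m m0 nm] := metric_norm_comparison Ac dx.
have ci : {for c x, continuous (chart_inv c)} by apply: chart_inv_at; exists x.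
have nm' : \forall w \near c x, forall v,
    m * `|v| <= metric_norm g c (chart_inv c w) v /\
    m * metric_norm g c (chart_inv c w) v <= `|v|.
  have nm0 : \forall y \near chart_inv c (c x), forall v,
      m * `|v| <= metric_norm g c y v /\ m * metric_norm g c y v <= `|v|.
    by rewrite chart_invK.
  exact: (ci _ nm0).
have nI : \forall w \near c x, (forall v,
    m * `|v| <= metric_norm g c (chart_inv c w) v /\
    m * metric_norm g c (chart_inv c w) v <= `|v|) /\ (c @` chart_dom c) w.
  by apply: filterI => //; exact: nbhs_chart_img.
have /nbhs_ballP[rho /= rho0 H] := nI.
exists rho, m; split => //.
  by move=> w wx; have [] := H w; rewrite // -ball_normE /= distrC.
move=> y v dy yx; have [|h _] := H (c y); first by rewrite -ball_normE /= distrC.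
by have := h v; rewrite chart_invK.
Qed.

Lemma near_coordinate_ball x (r : R) : 0 < r -> let c := chart_at A x in
  \forall y \near x, chart_dom c y /\ `|c y - c x| < r.
Proof.
move=> r0 c; have dx : chart_dom c x := chart_at_dom A x.
apply: filterI; first exact: nbhs_chart_dom.
by have := chart_map_at dx; rewrite /continuous_at => /cvgrPdistC_lt; exact.
Qed.

Lemma ball_line (p q o : 'rV[R]_n) (r s : R) : `|p - o| < r -> `|q - o| < r ->
  0 <= s <= 1 -> `|p + s *: (q - p) - o| < r.
Proof.
move=> pr qr /andP[s0 s1].
have -> : p + s *: (q - p) - o = (1 - s) *: (p - o) + s *: (q - o).
  by apply/rowP => i; rewrite !mxE; ring.
apply: le_lt_trans (ler_normD _ _) _; rewrite !normrZ (ger0_norm s0) ger0_norm; last by lra.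
have [s1'|s1'] := ltP s 1; last first.
  have -> : s = 1 by lra.
  by rewrite subrr mul0r add0r mul1r.
have h1 : (1 - s) * `|p - o| < (1 - s) * r by rewrite ltr_pM2l// subr_gt0.
have h2 : s * `|q - o| <= s * r by rewrite ler_wpM2l// ltW.
lra.
Qed.

(** The coordinate segment from [y] to [z] is a competitor for the infimum, and its speed is at most
    [m^-1] times the norm of its coordinate velocity. *)
Lemma edist_le_coordinates x rho m y z : coordinate_ball x rho m ->
  let c := chart_at A x in chart_dom c y -> chart_dom c z ->
  `|c y - c x| < rho -> `|c z - c x| < rho ->
  (edist y z <= (m^-1 * `|c z - c y|)%:E)%E.
Proof.
move=> [rho0 m0 img cmp] c dy dz yx zx.
have Ac : atlas_charts A c := chart_at_atlas A x.
pose w := c z - c y; pose line (t : R) : 'rV[R]_n := c y + t *: w.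
pose gam t := chart_inv c (line t).
have line_in t : 0 <= t <= 1 -> `|line t - c x| < rho by exact: ball_line.
have gam_dom t : 0 <= t <= 1 -> chart_dom c (gam t) /\ c (gam t) = line t.
  by move=> /line_in /img /chart_imgP.
have cline : continuous line.
  move=> t; apply: cvgD; first exact: cvg_cst.
  by apply: cvgZ; [exact: cvg_id|exact: cvg_cst].
have cgam t : 0 <= t <= 1 -> {for t, continuous gam}.
  move=> t01; apply: (@continuous_comp _ _ _ line (chart_inv c)); first exact: cline.
  by apply: chart_inv_at; exact/img/line_in.
have C : C1_curve A gam 0 1.
  apply/C1_curveP => //; split.
    apply/within_itv_continuousP => t /cgam ct.
    exact: (cvg_trans (cvg_app _ (@cvg_within _ _ _ _)) ct).
  move=> c' t Ac' t01 dt.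
  have smoothT := @atlas_smooth _ _ _ A c c' Ac Ac'.
  have trans_dom u : 0 <= u <= 1 -> chart_dom c' (gam u) ->
      (c @` (chart_dom c `&` chart_dom c')) (line u).
    by move=> u01 du; have [? <-] := gam_dom u u01; exists (gam u).
  exists (fun u => 'D_w (transition c c') (line u)); split.
    have nd : \forall u \near within `[0, 1] (nbhs t), chart_dom c' (gam u).
      apply: cvg_within; apply: (cgam t t01); exact: nbhs_chart_dom.
    have n01 : \forall u \near within `[0, 1] (nbhs t), [set` `[0, 1]] u by exact: withinT.
    apply: filterS2 nd n01 => u du; rewrite /= in_itv/= => u01.
    have [_ /(_ w) dT] := smoothT [::] (line u) (trans_dom u u01 du).
    have := derivable_line dT; apply: has_derive_withinS.
    exact: subsetT.
  have [cD _] := smoothT [:: w] (line t) (trans_dom t t01 dt).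
  have cDl : {for t, continuous (fun u => 'D_w (transition c c') (line u))}.
    by apply: (@continuous_comp _ _ _ line ('D_w (transition c c'))); [exact: cline|exact: cD].
  exact: (cvg_trans (cvg_app _ (@cvg_within _ _ _ _)) cDl).
have pw := pwC1_single (ltr01) C.
have g0 : gam 0 = y by rewrite /gam /line scale0r addr0 chart_invK.
have g1 : gam 1 = z.
  by rewrite /gam /line /w scale1r addrC subrK chart_invK.
have := edist_le_length g ltr01 pw; rewrite g0 g1 => /le_trans; apply.
have -> : m^-1 * `|c z - c y| = m^-1 * `|w| * (1 - 0) by rewrite subr0 mulr1.
apply: segment_integral_le => //.
- exact: pwC1_measurable_speed.
- by move=> u; exact: speed_ge0.
move=> u /andP[u0 u1]; have u01 : 0 <= u <= 1 by rewrite !ltW.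
have [du cu] := gam_dom u u01.
rewrite (speed_chart g Ac du (cgam u u01) (v := w)).
  have [|_ h] := cmp (gam u) w du; first by rewrite -/c cu; exact: line_in.
  by rewrite mulrC ler_pdivlMr// mulrC.
have hl : has_derive_within setT line u w.
  move=> e e0; exists 1 => // v _ _.
  have -> : line v - line u - (v - u) *: w = 0.
    by rewrite /line opprD addrACA subrr add0r -scalerBl subrr.
  by rewrite normr0 mulr_ge0// ltW.
apply: near_eq_has_derive_within hl => //.
have nu : \forall v \near u, [set` `]0, 1[] v by apply: nbhs_itv; rewrite u0.
apply: filterS nu => v; rewrite /= in_itv/= => /andP[v0 v1] _.
by have [|_ ->] := gam_dom v; rewrite ?ltW.
Qed.

Lemma edist_near x (e : R) : 0 < e -> \forall y \near x, (edist x y < e%:E)%E.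
Proof.
move=> e0; have [rho [m bx]] := exists_coordinate_ball x.
have [rho0 m0 _ _] := bx.
have r0 : 0 < Order.min rho (m * e) by rewrite lt_min rho0 mulr_gt0.
apply: filterS (near_coordinate_ball x r0) => y [dy]; rewrite lt_min => /andP[y1 y2].
have dx := chart_at_dom A x.
have xx : `|chart_at A x x - chart_at A x x| < rho by rewrite subrr normr0.
apply: le_lt_trans (edist_le_coordinates bx dx dy xx y1) _.
by rewrite lte_fin mulrC ltr_pdivrMr// mulrC.
Qed.

(* Truncating the coordinate distance to [x] makes it a Lipschitz function on all
   of [M], which bounds from below the length of curves that leave the chart. *)
Definition cut_dist x (rho : R) (z : M) : R := let c := chart_at A x in
  if `[< chart_dom c z /\ `|c z - c x| < rho / 2 >] then `|c z - c x| else rho / 2.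

Lemma cut_dist_in x rho z : let c := chart_at A x in chart_dom c z ->
  cut_dist x rho z = Order.min (rho / 2) `|c z - c x|.
Proof.
move=> c dz; rewrite /cut_dist -/c; case: asboolP => [[_ h]|h].
  by rewrite min_r// ltW.
by rewrite min_l// leNgt; apply/negP => h'; apply: h.
Qed.

(** The closed coordinate ball of radius [rho / 2] is compact, so its preimage in the chart is
    closed because [M] is Hausdorff, and [z] has a neighbourhood that avoids it. *)
Lemma near_cut_dist_out x rho m z : coordinate_ball x rho m ->
  ~ (chart_dom (chart_at A x) z /\ `|chart_at A x z - chart_at A x x| < rho) ->
  \forall y \near z, cut_dist x rho y = rho / 2.
Proof.
move=> [rho0 m0 img _]; set c := chart_at A x => zout.
pose K0 := [set w : 'rV[R]_n | `|w - c x| <= rho / 2].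
have rr : rho / 2 < rho by lra.
have K0img : K0 `<=` c @` chart_dom c.
  by move=> w /= wx; apply: img; exact: le_lt_trans wx rr.
have K0c : compact K0.
  apply: bounded_closed_compact.
    exists (rho / 2 + `|c x|); split; first exact: num_real.
    move=> b hb w /= wx; apply: le_trans (ltW hb).
    by rewrite -[w](subrK (c x)); apply: le_trans (ler_normD _ _) _; rewrite lerD2r.
  have -> : K0 = closed_ball (c x) (rho / 2).
    rewrite closed_ballE ?divr_gt0//; apply/seteqP.
    by split => w; rewrite /K0 /closed_ball_ /= distrC.
  exact: closed_ball_closed.
have Kc : closed (chart_inv c @` K0).
  apply: compact_closed => //; apply: continuous_compact K0c.
  exact: continuous_subspaceW K0img (@chart_inv_continuous _ _ _ c).
have zK : ~ (chart_inv c @` K0) z.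
  move=> [w wK wz]; apply: zout; have [dw cw] := chart_imgP (K0img w wK).
  by rewrite -wz; split => //; rewrite cw; exact: le_lt_trans wK rr.
have nK : \forall y \near z, (~` (chart_inv c @` K0)) y.
  by apply: open_nbhs_nbhs; split => //; exact: closed_openC.
apply: filterS nK => y yK; rewrite /cut_dist -/c; case: asboolP => // -[dy yx].
exfalso; apply: yK; exists (c y); last exact: chart_invK.
by rewrite /K0 /= ltW.
Qed.

(** The inequality is additive over adjacent intervals, so by Cousin's lemma it needs proof only
    near each [t]; the term in [e] absorbs the errors of the first-order expansions. *)
Lemma C1_cut_dist_le x rho m gam a b (e : R) : coordinate_ball x rho m -> a < b ->
  C1_curve A gam a b -> 0 < e ->
  ((m * (cut_dist x rho (gam b) - cut_dist x rho (gam a)))%:E <=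
   curve_length g gam a b + (e * (b - a))%:E)%E.
Proof.
move=> bx ab C e0; have [rho0 m0 img cmp] := bx; set c := chart_at A x in img cmp.
have Ac : atlas_charts A c := chart_at_atlas A x.
pose F := cut_dist x rho.
have pw := pwC1_single ab C.
have sub u v : a <= u -> u <= v -> v <= b -> pwC1 A gam u v.
  move=> au uv vb; have aub : a <= u <= b by rewrite au (le_trans uv).
  have uvb : u <= v <= b by rewrite uv.
  by have [_ h] := pwC1_split pw aub; have [] := pwC1_split h uvb.
have [/within_itv_continuousP cg _] := C.
apply: (@interval_local_to_global R (fun u v =>
  ((m * (F (gam v) - F (gam u)))%:E <=
   curve_length g gam u v + (e * (v - u))%:E)%E)); first exact: ltW.
  move=> u t v /andP[au ut] /andP[tv vb] h1 h2.
  have pwuv := sub u v au (le_trans ut tv) vb.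
  have utv : u <= t <= v by rewrite ut.
  rewrite (curve_length_split g pwuv utv).
  have -> : m * (F (gam v) - F (gam u)) =
      m * (F (gam t) - F (gam u)) + m * (F (gam v) - F (gam t)) by ring.
  have -> : e * (v - u) = e * (t - u) + e * (v - t) by ring.
  by rewrite !EFinD addeACA leeD.
move=> t tab; have ct := cg t tab.
(* The chart is used up to radius [rho] while the truncation is at [rho / 2]: around the remaining
   points [cut_dist] is constant and its increment vanishes. *)
have [[dt tx]|out] := pselect (chart_dom c (gam t) /\ `|c (gam t) - c x| < rho); last first.
  have nF : \forall u \near within `[a, b] (nbhs t), F (gam u) = rho / 2.
    exact: (ct _ (near_cut_dist_out bx out)).
  have /nbhs_ballP[r /= r0 H] := nF.
  exists r => // u v /andP[au ut] /andP[tv vb] tu vt.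
  have -> : F (gam u) = rho / 2.
    apply: H; first by rewrite /ball/= ltr_norml; apply/andP; lra.
    by rewrite /= in_itv/= au; apply/andP; lra.
  have -> : F (gam v) = rho / 2.
    apply: H; first by rewrite /ball/= ltr_norml; apply/andP; lra.
    by rewrite /= in_itv/= vb andbT; lra.
  rewrite subrr mulr0 adde_ge0//; first exact: curve_length_ge0.
  by rewrite lee_fin mulr_ge0 ?(ltW e0)// subr_ge0 (le_trans ut).
(* The increment in coordinates costs [m * e'] and the variation of the speed costs [e']. *)
pose e' := e / (1 + m).
have e'0 : 0 < e' by rewrite divr_gt0// addr_gt0.
have eE : e = e' * (1 + m) by rewrite /e' divfK// gt_eqF// addr_gt0.
have [v0 [hv cs]] := C1_curve_speed g ab C tab Ac dt.
have [s0 _] := cmp (gam t) v0 dt tx.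
have [d1 d10 H1] := hv e' e'0.
have /nbhs_ballP[d2 /= d20 H2] : \forall u \near within `]a, b[ (nbhs t),
    `|speed g gam u - metric_norm g c (gam t) v0| < e'.
  by move/cvgrPdistC_lt : cs; exact.
have /nbhs_ballP[d3 /= d30 H3] : \forall u \near within `[a, b] (nbhs t),
    chart_dom c (gam u) by apply: ct; exact: nbhs_chart_dom.
pose d := Order.min d1 (Order.min d2 d3).
have [dd1 dd2 dd3] : [/\ d <= d1, d <= d2 & d <= d3].
  by rewrite /d !ge_min !lexx !orbT.
have d0 : 0 < d by rewrite /d !lt_min d10 d20.
exists d => // u v /andP[au ut] /andP[tv vb] tu vt.
have uv := le_trans ut tv.
have uin : [set` `[a, b]] u by rewrite /= in_itv/= au (le_trans uv).
have vin : [set` `[a, b]] v by rewrite /= in_itv/= vb (le_trans au).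
have du : chart_dom c (gam u).
  by apply: H3 => //; rewrite /ball/= ltr_norml; apply/andP; lra.
have dv : chart_dom c (gam v).
  by apply: H3 => //; rewrite /ball/= ltr_norml; apply/andP; lra.
have hu : `|c (gam u) - c (gam t) - (u - t) *: v0| <= e' * (t - u).
  have := H1 u uin; rewrite /= distrC (ger0_norm (_ : 0 <= t - u)) ?subr_ge0//; apply.
  by lra.
have hv' : `|c (gam v) - c (gam t) - (v - t) *: v0| <= e' * (v - t).
  have := H1 v vin; rewrite /= (ger0_norm (_ : 0 <= v - t)) ?subr_ge0//; apply.
  by lra.
have cuv : `|c (gam v) - c (gam u)| <= (`|v0| + e') * (v - u).
  have -> : c (gam v) - c (gam u) =
      (c (gam v) - c (gam t) - (v - t) *: v0) -
      (c (gam u) - c (gam t) - (u - t) *: v0) + (v - u) *: v0.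
    rewrite (subrACA (c (gam v) - _)) (subrACA (c (gam v))) subrr subr0 -scalerBl.
    have -> : v - t - (u - t) = v - u by ring.
    by rewrite subrK.
  apply: le_trans (ler_normD _ _) _; rewrite normrZ.
  apply: le_trans (lerD (ler_normB _ _) (lexx _)) _.
  by rewrite ger0_norm ?subr_ge0//; lra.
have Fuv : F (gam v) - F (gam u) <= `|c (gam v) - c (gam u)|.
  rewrite /F !cut_dist_in//= -/c.
  have := lerB_dist (c (gam v) - c x) (c (gam u) - c x).
  rewrite opprB addrA subrK.
  set p := `|c (gam v) - c x|; set q := `|c (gam u) - c x|; set r := `|_ - _| => pq.
  have r0 : 0 <= r by exact: normr_ge0.
  by rewrite /Order.min; case: ifPn => h1; case: ifPn => h2; move: h1 h2; rewrite -?leNgt; lra.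
have len : (((metric_norm g c (gam t) v0 - e') * (v - u))%:E <=
    curve_length g gam u v)%E.
  apply: segment_integral_ge => //.
  - exact: pwC1_measurable_speed (sub u v au uv vb).
  - by move=> w; exact: speed_ge0.
  move=> w /andP[uw wv].
  have : `|speed g gam w - metric_norm g c (gam t) v0| < e'.
    apply: H2; first by rewrite /ball/= ltr_norml; apply/andP; lra.
    by rewrite /= in_itv/=; apply/andP; lra.
  by rewrite ltr_norml => /andP[]; lra.
apply: le_trans (leeD len (lexx _)); rewrite -EFinD lee_fin.
apply: (@le_trans _ _ (m * ((`|v0| + e') * (v - u)))).
  by rewrite ler_pM2l//; exact: le_trans Fuv cuv.
have s0' : m * `|v0| * (v - u) <= metric_norm g c (gam t) v0 * (v - u).
  by rewrite ler_wpM2r// subr_ge0.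
rewrite eE; lra.
Qed.

Lemma pwC1_cut_dist_le x rho m gam a b : coordinate_ball x rho m -> pwC1 A gam a b ->
  ((m * (cut_dist x rho (gam b) - cut_dist x rho (gam a)))%:E <=
   curve_length g gam a b)%E.
Proof.
move=> bx; elim=> {a b} [a|a t b at_ C h IH].
  by rewrite subrr mulr0 curve_length_nil.
have pw : pwC1 A gam a b by exact: PwC1Cons h.
rewrite (curve_length_split (t := t) g pw); last by rewrite (ltW at_) (pwC1_le h).
have -> : m * (cut_dist x rho (gam b) - cut_dist x rho (gam a)) =
    m * (cut_dist x rho (gam t) - cut_dist x rho (gam a)) +
    m * (cut_dist x rho (gam b) - cut_dist x rho (gam t)) by ring.
rewrite EFinD; apply: leeD IH; apply/lee_addgt0Pr => e e0.
have ta0 : 0 < t - a by rewrite subr_gt0.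
have := C1_cut_dist_le bx at_ C (divr_gt0 e0 ta0).
by rewrite divfK// gt_eqF.
Qed.

(** If [z] were outside, [cut_dist] would grow from less than [rho / 4] at [y] to [rho / 2] at [z],
    so every curve between them would have length at least [m * (rho / 4)]. *)
Lemma edist_lt_coordinate_ball x rho m y z : coordinate_ball x rho m ->
  let c := chart_at A x in chart_dom c y -> `|c y - c x| < rho / 4 ->
  (edist y z < (m * (rho / 4))%:E)%E -> chart_dom c z /\ `|c z - c x| < rho.
Proof.
move=> bx c dy yx yz; have [rho0 m0 _ _] := bx.
apply: contrapT => out.
have Fz : cut_dist x rho z = rho / 2 by exact: nbhs_singleton (near_cut_dist_out bx out).
have Fy : cut_dist x rho y = `|c y - c x|.
  by rewrite cut_dist_in//= -/c min_r//; lra.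
have [a [b [gam [ab pw ga gb]]]] := edist_ltP yz.
apply/negP; rewrite -leNgt; apply: le_trans (pwC1_cut_dist_le bx pw).
rewrite ga gb Fz Fy lee_fin ler_pM2l//; lra.
Qed.

End LocalComparison.

(** * The geodesic distance *)

Section GeodesicDistance.
Variables (R : realType) (n : nat) (M : topologicalType).
Variables (A : smooth_atlas R n M) (g : riemannian_metric A).
Hypothesis M_hausdorff : hausdorff_space M.
Hypothesis M_compact : compact [set: M].
Hypothesis M_connected : connected [set: M].
Implicit Types (x y z : M).
Local Notation edist := (edist g).
Local Notation d := (geodesic_dist g).

(** The points at finite distance from [x] form a nonempty set that is open and closed, since nearby
    points are at distance less than 1 from each other. *)
Lemma edist_fin x y : edist x y \is a fin_num.
Proof.
rewrite ge0_fin_numE ?edist_ge0//.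
suff : [set y | (edist x y < +oo)%E] = [set: M].
  by move=> /seteqP[_ h]; exact: (h y I).
have add u v w : (edist u v < +oo)%E -> (edist v w < 1%:E)%E -> (edist u w < +oo)%E.
  move=> uv vw; have uvf : edist u v \is a fin_num by rewrite ge0_fin_numE ?edist_ge0.
  have uv1 : (edist u v < (fine (edist u v) + 1)%:E)%E.
    by rewrite EFinD fineK// lteDl// lte_fin ltr01.
  exact: lt_trans (edist_lt_add uv1 vw) (ltry _).
have near1 u := edist_near g u (@ltr01 R).
have oB : open [set y | (edist x y < +oo)%E].
  rewrite openE => u xu; rewrite /interior; apply: filterS (near1 u) => v.
  exact: add.
have cB : closed [set y | (edist x y < +oo)%E].
  rewrite -[X in closed X]setCK; apply: open_closedC.
  rewrite openE => u /= xu; rewrite /interior; apply: filterS (near1 u) => v uv.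
  by move=> /= xv; apply: xu; apply: (add x v u) => //; rewrite edist_sym.
apply: M_connected.
- exists x; have : (edist x x < 1%:E)%E by exact: nbhs_singleton (near1 x).
  by move=> /lt_trans; apply; exact: ltry.
- by exists [set y | (edist x y < +oo)%E] => //; rewrite setTI.
- by exists [set y | (edist x y < +oo)%E] => //; rewrite setTI.
Qed.

Lemma geodesic_distK x y : (d x y)%:E = edist x y.
Proof. by rewrite geodesic_distE fineK// edist_fin. Qed.

Lemma geodesic_dist_ge0 x y : 0 <= d x y.
Proof. by rewrite geodesic_distE fine_ge0// edist_ge0. Qed.

Lemma geodesic_dist_near x (e : R) : 0 < e -> nbhs x [set y | d x y < e].
Proof.
move=> e0; apply: filterS (edist_near g x e0) => y /=.
by rewrite -geodesic_distK lte_fin.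
Qed.

Lemma geodesic_distxx x : d x x = 0.
Proof.
apply/eqP; rewrite eq_le geodesic_dist_ge0 andbT; apply/ler_addgt0Pr => e e0.
by rewrite add0r ltW//; exact: (nbhs_singleton (geodesic_dist_near x e0)).
Qed.

Lemma geodesic_dist_sym x y : d x y = d y x.
Proof. by rewrite !geodesic_distE edist_sym. Qed.

Lemma geodesic_dist_triangle x y z : d x z <= d x y + d y z.
Proof.
apply/ler_addgt0Pr => e e0.
have e2 : 0 < e / 2 by rewrite divr_gt0.
have lt_e u v : (edist u v < (d u v + e / 2)%:E)%E.
  by rewrite -geodesic_distK lte_fin ltrDl.
have := edist_lt_add (lt_e x y) (lt_e y z).
by rewrite -geodesic_distK lte_fin; lra.
Qed.

Lemma geodesic_dist_continuous x : continuous (d x).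
Proof.
move=> y; apply/cvgrPdist_le => e e0; apply: filterS (geodesic_dist_near y e0) => z /= yz.
have h1 := geodesic_dist_triangle x y z; have h2 := geodesic_dist_triangle x z y.
by rewrite ler_norml; rewrite (geodesic_dist_sym z) in h2; apply/andP; lra.
Qed.

Lemma geodesic_dist_le_length gam a b : a <= b -> pwC1 A gam a b ->
  ((d (gam a) (gam b))%:E <= curve_length g gam a b)%E.
Proof.
rewrite le_eqVlt => /predU1P[<- _|ab pw].
  by rewrite geodesic_distxx curve_length_ge0.
by rewrite geodesic_distK; exact: edist_le_length.
Qed.

(** Any point of an almost minimal curve cuts it into two curves, whose lengths bound the two
    distances. *)
Lemma near_geodesic x y (e : R) : 0 < e -> exists p : R -> M,
  [/\ continuous p, p 0 = x, p 1 = y & forall t, d x (p t) + d (p t) y <= d x y + e].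
Proof.
move=> e0; have : (edist x y < (d x y + e)%:E)%E.
  by rewrite -geodesic_distK lte_fin ltrDl.
move=> /edist_ltP[a [b [gam [ab pw ga gb len]]]].
pose s t := a + clamp 0 1 t * (b - a).
have sab t : a <= s t <= b.
  have /andP[c0 c1] := @clamp_itv R 0 1 t ler01.
  have : clamp 0 1 t * (b - a) <= 1 * (b - a) by rewrite ler_wpM2r// subr_ge0 ltW.
  have : 0 <= clamp 0 1 t * (b - a) by rewrite mulr_ge0// subr_ge0 ltW.
  by rewrite /s mul1r => ? ?; apply/andP; lra.
exists (gam \o s); split.
- apply: (continuous_within_comp (pwC1_continuous pw)).
    move=> t; apply: cvgD; first exact: cvg_cst.
    by apply: cvgM; [exact: continuous_clamp|exact: cvg_cst].
  by move=> t; rewrite /= in_itv/=; exact: sab.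
- by rewrite /= /s clamp_id ?lexx ?ler01// mul0r addr0.
- by rewrite /= /s clamp_id ?lexx ?ler01// mul1r addrC subrK.
- move=> t /=; have /andP[as_ sb] := sab t.
  have [pw1 pw2] := pwC1_split pw (sab t).
  rewrite -lee_fin; apply: le_trans (ltW len).
  rewrite (curve_length_split g pw (sab t)) EFinD -ga -gb.
  by apply: leeD; exact: geodesic_dist_le_length.
Qed.

(** The intermediate value theorem for the distance to [x] along an almost minimal path. *)
Lemma geodesic_dist_between x y (t e : R) : 0 <= t <= d x y -> 0 < e ->
  exists z, d x z <= t /\ d z y <= d x y - t + e.
Proof.
move=> /andP[t0 txy] e0; have [p [cp p0 p1 dp]] := near_geodesic x y e0.
have cdp : {within `[0, 1], continuous (fun s => d x (p s))}.
  apply: continuous_subspaceT; apply: continuous_compose cp _.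
  exact: geodesic_dist_continuous.
have [|s _ st] := IVT (ler01) cdp (v := t).
  by rewrite p0 p1 geodesic_distxx min_l ?geodesic_dist_ge0// max_r ?geodesic_dist_ge0// t0.
by exists (p s); have := dp s; rewrite st; split; lra.
Qed.

Lemma geodesic_ball_path u v (r : R) : d u v < r -> exists p : R -> M,
  [/\ continuous p, p 0 = u, p 1 = v & forall t, d u (p t) < r].
Proof.
move=> uvr; have e0 : 0 < (r - d u v) / 2 by lra.
have [p [cp p0 p1 dp]] := near_geodesic u v e0.
exists p; split => // t; have := dp t; have := geodesic_dist_ge0 (p t) v; lra.
Qed.

Lemma coordinate_ball_deformable x rho m : coordinate_ball g x rho m ->
  deformable R [set z | chart_dom (chart_at A x) z /\
    `|chart_at A x z - chart_at A x x| < rho].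
Proof.
move=> [rho0 m0 img _]; set c := chart_at A x in img *.
pose line (p : R * (M * M)) := c p.2.1 + p.1 *: (c p.2.2 - c p.2.1).
exists (fun p => chart_inv c (line p)); split.
- move=> s y z s01 [dy yx] [dz zx].
  apply: (@continuous_comp _ _ _ line (chart_inv c)); last first.
    by apply: chart_inv_at; apply: img; exact: ball_line.
  have c1 : c p.2.1 @[p --> (s, (y, z))] --> c y.
    apply: (@cvg_comp _ _ _ (fun p : R * (M * M) => p.2.1) c _ (nbhs y)).
      by apply: cvg_comp; [exact: cvg_snd|exact: cvg_fst].
    exact: chart_map_at.
  have c2 : c p.2.2 @[p --> (s, (y, z))] --> c z.
    apply: (@cvg_comp _ _ _ (fun p : R * (M * M) => p.2.2) c _ (nbhs z)).
      by apply: cvg_comp; [exact: cvg_snd|exact: cvg_snd].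
    exact: chart_map_at.
  apply: cvgD; first exact: c1.
  by apply: cvgZ; [exact: cvg_fst|exact: cvgB c2 c1].
- by move=> y z [dy _] _; rewrite /line /= scale0r addr0 chart_invK.
- by move=> y z _ [dz _]; rewrite /line /= scale1r addrC subrK chart_invK.
- by move=> s y _ [dy _]; rewrite /line /= subrr scaler0 addr0 chart_invK.
Qed.

(** A Lebesgue number. Around a centre [x], the radius [m * (rho / 4)] serves all [y] within
    [rho / 4] of [x] in coordinates, by [edist_lt_coordinate_ball]; compactness makes the radius
    uniform. *)
Lemma exists_deformable_radius : exists2 r : R, 0 < r &
  forall y, exists2 B, deformable R B & forall z, d y z < r -> B z.
Proof.
have /compact_near_coveringP cover := M_compact.
pose P (r : R) y := exists2 B, deformable R B & forall z, d y z < r -> B z.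
have local x : [set: M] x -> \forall y \near x & r \near (0 : R)^'+, P r y.
  move=> _; have [rho [m bx]] := exists_coordinate_ball g x.
  have [rho0 m0 _ _] := bx.
  have rho4 : 0 < rho / 4 by lra.
  have mr : 0 < m * (rho / 4) by exact: mulr_gt0.
  exists ([set y | chart_dom (chart_at A x) y /\
      `|chart_at A x y - chart_at A x x| < rho / 4], [set r | r < m * (rho / 4)]).
    by split; [exact: near_coordinate_ball|exact: nbhs_right_lt].
  move=> [y r] [/= [dy yx] rm].
  exists [set z | chart_dom (chart_at A x) z /\
    `|chart_at A x z - chart_at A x x| < rho].
    exact: coordinate_ball_deformable bx.
  move=> z yz; apply: (edist_lt_coordinate_ball M_hausdorff bx dy yx).
  by rewrite -geodesic_distK lte_fin (lt_trans yz).
have [r [r0 Pr]] : exists r : R, 0 < r /\ [set: M] `<=` P r.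
  have : \forall r \near (0 : R)^'+, 0 < r /\ [set: M] `<=` P r.
    by apply: filterI; [exact: nbhs_right_gt|exact: (cover R _ P _ local)].
  by move=> /filter_ex.
by exists r => // y; exact: Pr.
Qed.

Lemma geodesic_path_connected : path_connected R M.
Proof.
move=> x y; have [p [cp p0 p1 _]] := near_geodesic x y (@ltr01 R).
by exists p; split => //; exact: continuous_subspaceT.
Qed.

End GeodesicDistance.

Theorem mainTheorem1 (R : realType) (n : nat) (M : topologicalType)
    (A : smooth_atlas R n M)
    (M_hausdorff : hausdorff_space M)
    (M_second_countable : @second_countable M)
    (M_compact : compact [set: M])
    (M_connected : connected [set: M])
    (M_not_simply_connected : ~ simply_connected R M)
    (g : riemannian_metric A) (lam : R) (lam_gt0 : 0 < lam) :
  ~ positive_definite_kernel (gaussian_kernel g lam).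
Proof.
move=> kpd; apply: M_not_simply_connected.
have d_ge0 := geodesic_dist_ge0 g.
have d_xx := geodesic_distxx g M_connected.
have d_sym := geodesic_dist_sym g.
have d_tri := geodesic_dist_triangle g M_connected.
apply: simply_connected_null_loops; first exact: (geodesic_path_connected g M_connected).
move=> x0 f lf; apply: contrapT => nf.
have [r r0 good] := exists_deformable_radius g M_hausdorff M_compact M_connected.
(* The scale of the chains is [r / 2], since balls of twice that radius have to be deformable. *)
have delta0 : 0 < r / 2 by rewrite divr_gt0.
have ess : essential_lengths (geodesic_dist g) (r / 2) !=set0.
  apply: (essential_loop_lengths d_ge0 d_xx d_sym d_tri _ delta0 _ _ lf nf).
  - by move=> x e; exact: geodesic_dist_near.
  - move=> y; have [B dB yB] := good y; exists B => // z yz; apply: yB.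
    by move: yz; rewrite mulrC divfK.
  - by move=> u v; exact: geodesic_ball_path.
have [L0 conf] := circle_configuration d_ge0 d_xx d_sym d_tri delta0
  (@geodesic_dist_between _ _ _ _ g M_connected) ess.
(* Here D is half the systole, and [gaussian_kernel] unfolds to [gauss] of the distance, so that
   [kpd] applies as it stands. *)
apply: (gauss_not_positive_definite lam_gt0 d_ge0 d_xx d_sym _ conf) => //.
by rewrite divr_gt0.
Qed.
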